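(* Let $F=u\,\phi(r,s)$ be a spherically symmetric Finsler metric on a domain $\Omega\subseteq\mathbb{R}^n$, where $r=|x|$, $u=|y|$, $s=\frac{\langle x,y\rangle}{|y|}$, and let \[Q=\frac{1}{2r}\,\frac{-\phi_r+s\phi_{rs}+r\phi_{ss}}{\phi-s\phi_s+(r^2-s^2)\phi_{ss}},\qquad P=-\frac{1}{\phi}\big(s\phi+(r^2-s^2)\phi_s\big)Q+\frac{1}{2r\phi}(s\phi_r+r\phi_s).\] Then $(\Omega,F)$ has constant flag curvature $K$ if and only if the following three equations hold: \[2Q-\frac{s}{r}P_r-P_s+2(r^2-s^2)P_sQ+P^2+2sPQ=K\phi^2,\] \[\frac{1}{2r}P_r-\frac{s}{2r}P_{rs}-\frac{1}{2}P_{ss}+PQ-sP_sQ+(r^2-s^2)P_{ss}Q=0,\] \[\frac{2}{r}Q_r-Q_{ss}-\frac{s}{r}Q_{rs}+2(r^2-s^2)QQ_{ss}+4Q^2-(r^2-s^2)Q_s^2-2sQQ_s=0.\]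
   Context: Here $\langle\cdot,\cdot\rangle$ and $|\cdot|$ are the standard Euclidean inner product and norm, $x\in\Omega$, and $y\in T_x\Omega\cong\mathbb{R}^n$ is nonzero. A Finsler metric $F=F(x,y)$ on $\Omega$ is called spherically symmetric if it is invariant under all rotations of $\mathbb{R}^n$; then $F=u\,\phi(r,s)$ for a positive function $\phi$ of two variables. Subscripts $r,s$ denote partial derivatives. With $g_{ij}=\frac12\frac{\partial^2F^2}{\partial y^i\partial y^j}$ and inverse $g^{ij}$, the geodesic spray coefficients are $G^i=\frac14 g^{il}\{(F^2)_{x^ky^l}y^k-(F^2)_{x^l}\}$ (summation convention); for spherically symmetric $F$ they equal $G^i=uPy^i+u^2Qx^i$ with the $P,Q$ of the claim. The Riemann curvature is \[R^i_{\ j}=2(G^i)_{x^j}-y^k(G^i)_{x^ky^j}+2G^k(G^i)_{y^ky^j}-(G^i)_{y^k}(G^k)_{y^j}.\] For a tangent plane $\Pi=\mathrm{span}\{y,w\}\subset T_x\Omega$ the flag curvature is \[K(\Pi,y)=\frac{g_{ij}R^i_{\ k}w^jw^k}{F^2g_{ij}w^iw^j-[g_{ij}y^iw^j]^2}.\] $F$ has constant flag curvature $K$ if $K(\Pi,y)=K$ is a constant for all flags; equivalently $R^i_{\ j}=KF^2\big(\delta^i_{\ j}-\frac{y^i}{F}F_{y^j}\big)$.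
   Formalization: The dimension is assumed to be n ≥ 3; for n = 2 the claim fails (the flat cone φ² = c² + (1−c²)s²/r², 0 < c < 1, on an annulus has K = 0 but violates the first equation), and for n = 1 there are no flags. *)

(* Defs.v *)
From HB Require Import structures.
From mathcomp Require Import all_boot all_order all_algebra.
From mathcomp Require Import all_classical all_reals all_analysis.

Set Implicit Arguments.
Unset Strict Implicit.
Unset Printing Implicit Defensive.

Import Order.TTheory GRing.Theory Num.Theory.
Import numFieldNormedType.Exports.

Local Open Scope classical_set_scope.
Local Open Scope ring_scope.

(* The library norm `|x| on 'rV[R]_n is the sup norm, so the Euclidean norm has
   to be introduced separately; both induce the same topology. *)
Definition dot (R : realType) (n : nat) (x y : 'rV[R]_n) : R :=
  \sum_(i < n) x 0 i * y 0 i.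

Definition enorm (R : realType) (n : nat) (x : 'rV[R]_n) : R :=
  Num.sqrt (dot x x).

(* Class C^k on an open set U.  Asking for derivatives in every direction v
   agrees, in finite dimension, with asking for the partial derivatives. *)
Fixpoint Ck_on (R : realType) (V : normedModType R) (k : nat) (U : set V)
    (f : V -> R) : Prop :=
  (forall x, U x -> {for x, continuous f}) /\
  (if k is k'.+1 then
     forall v : V, (forall x, U x -> derivable f x v) /\
                   Ck_on k' U (fun x => 'D_v f x)
   else True).

Definition smooth_on (R : realType) (V : normedModType R) (U : set V)
    (f : V -> R) : Prop := forall k, Ck_on k U f.

Definition domain (R : realType) (n : nat) (Omega : set 'rV[R]_n) : Prop :=
  [/\ Omega !=set0, open Omega & connected Omega].

Definition rotation (R : realType) (n : nat) (A : 'M[R]_n) : Prop :=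
  A *m A^T = 1%:M /\ \det A = 1.

Section TangentBundle.
Context (R : realType) (n : nat).

(* Scalar functions of (x, y), where x is the position and y is a tangent
   vector. *)
Let fTM := 'rV[R]_n -> 'rV[R]_n -> R.

Definition dx (i : 'I_n) (f : fTM) : fTM :=
  fun x y => 'D_(delta_mx 0 i) (fun z : 'rV[R]_n => f z y) x.

Definition dy (i : 'I_n) (f : fTM) : fTM :=
  fun x y => 'D_(delta_mx 0 i) (fun z : 'rV[R]_n => f x z) y.

Definition sqrF (F : fTM) : fTM := fun x y => F x y ^+ 2.

Definition fundamental_tensor (F : fTM) (x y : 'rV[R]_n) : 'M[R]_n :=
  \matrix_(i, j) (2^-1 * dy j (dy i (sqrF F)) x y).

Definition Finsler_metric (Omega : set 'rV[R]_n) (F : fTM) : Prop :=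
  [/\ smooth_on [set p : 'rV[R]_n * 'rV[R]_n | Omega p.1 /\ p.2 != 0]
        (fun p => F p.1 p.2),
      (forall x y : 'rV[R]_n, Omega x -> y != 0 -> 0 < F x y),
      (forall (x y : 'rV[R]_n) (l : R), Omega x -> y != 0 -> 0 < l ->
         F x (l *: y) = l * F x y) &
      (forall x y v : 'rV[R]_n, Omega x -> y != 0 -> v != 0 ->
         0 < (v *m fundamental_tensor F x y *m v^T) 0 0)].

Definition spherically_symmetric (Omega : set 'rV[R]_n) (F : fTM) : Prop :=
  forall A : 'M[R]_n, rotation A ->
    forall x : 'rV[R]_n, Omega x ->
      Omega (x *m A) /\ (forall y : 'rV[R]_n, y != 0 -> F (x *m A) (y *m A) = F x y).

Definition spray (F : fTM) (i : 'I_n) : fTM := fun x y =>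
  4^-1 * \sum_(l < n) invmx (fundamental_tensor F x y) i l *
    (\sum_(k < n) dy l (dx k (sqrF F)) x y * y 0 k - dx l (sqrF F) x y).

Definition Riemann_curvature (F : fTM) (i j : 'I_n) : fTM := fun x y =>
  2 * dx j (spray F i) x y
  - \sum_(k < n) y 0 k * dy j (dx k (spray F i)) x y
  + 2 * \sum_(k < n) spray F k x y * dy j (dy k (spray F i)) x y
  - \sum_(k < n) dy k (spray F i) x y * dy j (spray F k) x y.

(* The flag is the plane spanned by y and w, with pole y. *)
Definition flag_curvature (F : fTM) (x y w : 'rV[R]_n) : R :=
  let g := fundamental_tensor F x y in
  (\sum_(i < n) \sum_(j < n) \sum_(k < n)
     g i j * Riemann_curvature F i k x y * w 0 j * w 0 k)
  / (F x y ^+ 2 * (\sum_(i < n) \sum_(j < n) g i j * w 0 i * w 0 j)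
     - (\sum_(i < n) \sum_(j < n) g i j * y 0 i * w 0 j) ^+ 2).

Definition constant_flag_curvature (Omega : set 'rV[R]_n) (F : fTM) (K : R)
    : Prop :=
  forall x y w : 'rV[R]_n, Omega x -> free [:: y; w] -> flag_curvature F x y w = K.

(* The pairs (r, s) = (|x|, <x, y>/|y|) with x in Omega, x != 0 and y != 0; the
   point x = 0 is left out because of the factors 1/r. *)
Definition rs_domain (Omega : set 'rV[R]_n) : set (R * R) :=
  [set p | [/\ exists2 x, Omega x & enorm x = p.1, 0 < p.1 & `|p.2| <= p.1]].

(* F = u * phi(r, s).  On the boundary |s| = r the two-sided partial
   derivatives of phi only make sense for a smooth extension of phi across it,
   whence the neighbourhood U; the values there are those of the one-sided
   limits from |s| < r and do not depend on the extension. *)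
Definition spherical_profile (Omega : set 'rV[R]_n) (F : fTM)
    (phi : R -> R -> R) : Prop :=
  [/\ (forall x y : 'rV[R]_n, Omega x -> y != 0 ->
         F x y = enorm y * phi (enorm x) (dot x y / enorm y)),
      (forall r s : R, rs_domain Omega (r, s) -> 0 < phi r s) &
      (exists U : set (R * R), [/\ open U, rs_domain Omega `<=` U &
         smooth_on U (fun p => phi p.1 p.2)])].

End TangentBundle.

Section Profile.
Context (R : realType).

Definition dr (f : R -> R -> R) : R -> R -> R :=
  fun r s => derive1 (fun t => f t s) r.

Definition ds (f : R -> R -> R) : R -> R -> R :=
  fun r s => derive1 (fun t => f r t) s.

Definition spray_Q (phi : R -> R -> R) : R -> R -> R := fun r s =>
  1 / (2 * r) *
  ((- dr phi r s + s * ds (dr phi) r s + r * ds (ds phi) r s) /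
   (phi r s - s * ds phi r s + (r ^+ 2 - s ^+ 2) * ds (ds phi) r s)).

Definition spray_P (phi : R -> R -> R) : R -> R -> R := fun r s =>
  - (1 / phi r s) * (s * phi r s + (r ^+ 2 - s ^+ 2) * ds phi r s)
    * spray_Q phi r s
  + 1 / (2 * r * phi r s) * (s * dr phi r s + r * ds phi r s).

End Profile.

(* Main.v *)
Require Import Defs.
From HB Require Import structures.
From mathcomp Require Import all_boot all_order all_algebra.
From mathcomp Require Import all_classical all_reals all_analysis.
From mathcomp Require Import ring lra.

Set Implicit Arguments.
Unset Strict Implicit.
Unset Printing Implicit Defensive.

Import Order.TTheory GRing.Theory Num.Theory.
Import numFieldNormedType.Exports.

Local Open Scope classical_set_scope.
Local Open Scope ring_scope.

(* Write r = |x|, u = |y|, s = <x,y>/u.  Where x, y <> 0 the chain rule gives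
   closed forms of the fundamental tensor and of the spray uPy + u^2Qx, whence
     R^i_j = A (u^2 delta_ij - y_i y_j) - (u C x_i + B y_i) h_j,
   with h = s y - u x, A the left-hand side of the first equation, C that of
   the third, and B = 3 E - A_s / 2 where E is that of the second one.  For a
   flag (y, w) the numerator of the flag curvature minus K times its denominator
   is then
     (A - K phi^2)(u^2 g(w,w) - <y,w> g(y,w))
       - h(w) g(u C x + (B + K phi phi_s) y, w).
   If |s| < r, this vanishes for all w iff A = K phi^2, C = 0 and
   B = - K phi phi_s (n >= 3 provides w orthogonal to x and y); since A = K phi^2
   also holds for nearby s, the last condition amounts to E = 0.  If |s| = r,
   then h = 0, so only the first equation matters for the curvature, and the
   other two follow by continuity in s.  The point x = 0 is reached by continuity
   of the curvature, all objects being smooth on the slit tangent bundle. *)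

(** * Functions of class C^k *)

Section SmoothCalculus.
Context (R : realType) (V : normedModType R).
Implicit Types (U : set V) (f g : V -> R) (k : nat).

Lemma near_eq_continuous f g x : (\near x, f x = g x) ->
  {for x, continuous f} -> {for x, continuous g}.
Proof.
move=> fg cf; have fgx := nbhs_singleton fg.
rewrite /prop_for /continuous_at -fgx.
apply: cvg_trans cf; apply: near_eq_cvg.
by apply: filterS fg => y /esym.
Qed.

Lemma near_open U x (P : V -> Prop) : open U -> U x -> (forall y, U y -> P y) ->
  \near x, P x.
Proof. by move=> oU Ux UP; apply: filterS (open_nbhs_nbhs (conj oU Ux)). Qed.

(** Openness of [U] turns equality on [U] into equality near each of its points, so directional
    derivatives agree on [U] and the induction applies to them. *)
Lemma Ck_on_ext k U f g : open U -> (forall x, U x -> f x = g x) ->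
  Ck_on k U f -> Ck_on k U g.
Proof.
move=> oU; elim: k f g => [|k IH] f g fg /= [cf df]; split.
- by move=> x Ux; apply: near_eq_continuous (cf x Ux); apply: near_open fg.
- by [].
- by move=> x Ux; apply: near_eq_continuous (cf x Ux); apply: near_open fg.
- move=> v; have [dfv Df] := df v; split.
    by move=> x Ux; apply: near_eq_derivable (dfv x Ux); apply: near_open fg.
  apply: IH Df => x Ux; apply: near_eq_derive; exact: near_open fg.
Qed.

Lemma Ck_on_sub k U U' f : U' `<=` U -> Ck_on k U f -> Ck_on k U' f.
Proof.
move=> sU; elim: k f => [|k IH] f /= [cf df]; split => //.
- by move=> x /sU /cf.
- by move=> x /sU /cf.
- by move=> v; have [dv Dv] := df v; split; [move=> x /sU /dv|exact: IH].
Qed.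

(** Serves the product and quotient rules, where the derivative again contains the functions
    themselves, with one order of smoothness to spare. *)
Lemma Ck_on_pred k U f : Ck_on k.+1 U f -> Ck_on k U f.
Proof.
elim: k f => [|k IH] f [cf df]; split => // v.
by have [dv Dv] := df v; split => //; exact: IH.
Qed.

Lemma Ck_on_cst k U (c : R) : Ck_on k U (fun=> c).
Proof.
elim: k c => [|k IH] c; split => //; try by move=> x _; exact: cvg_cst.
move=> v; split; first by move=> x _; exact: derivable_cst.
by under [X in Ck_on _ _ X]eq_fun do rewrite derive_cst.
Qed.

Lemma Ck_onD k U f g : open U -> Ck_on k U f -> Ck_on k U g ->
  Ck_on k U (fun x => f x + g x).
Proof.
move=> oU; elim: k f g => [|k IH] f g [cf df] [cg dg]; split => //;
  try by move=> x Ux; exact: cvgD (cf x Ux) (cg x Ux).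
move=> v; have [dfv Df] := df v; have [dgv Dg] := dg v; split.
  by move=> x Ux; exact: derivableD (dfv x Ux) (dgv x Ux).
apply: Ck_on_ext (IH _ _ Df Dg) => // x Ux.
by rewrite -deriveD ?dfv ?dgv//; [exact: dfv|exact: dgv].
Qed.

Lemma Ck_onM k U f g : open U -> Ck_on k U f -> Ck_on k U g ->
  Ck_on k U (fun x => f x * g x).
Proof.
move=> oU; elim: k f g => [|k IH] f g.
  move=> [cf df] [cg dg]; split => // x Ux; exact: cvgM (cf x Ux) (cg x Ux).
move=> Cf Cg; have Cf' := Ck_on_pred Cf; have Cg' := Ck_on_pred Cg.
case: Cf Cg => [cf df] [cg dg]; split.
  by move=> x Ux; exact: cvgM (cf x Ux) (cg x Ux).
move=> v; have [dfv Df] := df v; have [dgv Dg] := dg v; split.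
  by move=> x Ux; exact: derivableM (dfv x Ux) (dgv x Ux).
apply: Ck_on_ext (Ck_onD oU (IH _ _ Cf' Dg) (IH _ _ Cg' Df)) => // x Ux.
by rewrite -[RHS]/('D_v (f * g) x) deriveM//; [exact: dfv|exact: dgv].
Qed.

Lemma Ck_onV k U f : open U -> (forall x, U x -> f x != 0) ->
  Ck_on k U f -> Ck_on k U (fun x => (f x)^-1).
Proof.
move=> oU f0; elim: k f f0 => [|k IH] f f0.
  by move=> [cf df]; split => // x Ux; exact: cvgV (f0 x Ux) (cf x Ux).
move=> Cf; have Cf' := Ck_on_pred Cf; case: Cf => [cf df]; split.
  by move=> x Ux; exact: cvgV (f0 x Ux) (cf x Ux).
move=> v; have [dfv Df] := df v; split.
  by move=> x Ux; exact: derivableV (f0 x Ux) (dfv x Ux).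
have CV := IH _ f0 Cf'.
have := Ck_onM oU (Ck_onM oU (Ck_onM oU CV CV) (Ck_on_cst k U (-1))) Df.
apply: Ck_on_ext => // x Ux.
by rewrite (deriveV (f0 x Ux) (dfv x Ux)) /GRing.scale/= mulrN1 invrM ?unitfE ?f0 ?exprVn.
Qed.

Lemma smooth_on_ext U f g : open U -> (forall x, U x -> f x = g x) ->
  smooth_on U f -> smooth_on U g.
Proof. by move=> oU fg Cf k; exact: Ck_on_ext (Cf k). Qed.

Lemma smooth_on_sub U U' f : U' `<=` U -> smooth_on U f -> smooth_on U' f.
Proof. by move=> UU' Cf k; exact: Ck_on_sub (Cf k). Qed.

Lemma smooth_on_cst U (c : R) : smooth_on U (fun=> c).
Proof. by move=> k; exact: Ck_on_cst. Qed.

Lemma smooth_onD U f g : open U -> smooth_on U f -> smooth_on U g ->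
  smooth_on U (fun x => f x + g x).
Proof. by move=> oU Cf Cg k; exact: Ck_onD. Qed.

Lemma smooth_onM U f g : open U -> smooth_on U f -> smooth_on U g ->
  smooth_on U (fun x => f x * g x).
Proof. by move=> oU Cf Cg k; exact: Ck_onM. Qed.

Lemma smooth_onN U f : open U -> smooth_on U f -> smooth_on U (fun x => - f x).
Proof.
move=> oU Cf; apply: smooth_on_ext (smooth_onM oU (smooth_on_cst U (-1)) Cf) => // x _.
by rewrite mulN1r.
Qed.

Lemma smooth_onB U f g : open U -> smooth_on U f -> smooth_on U g ->
  smooth_on U (fun x => f x - g x).
Proof. by move=> oU Cf Cg; apply: smooth_onD => //; exact: smooth_onN. Qed.

Lemma smooth_onX U f m : open U -> smooth_on U f -> smooth_on U (fun x => f x ^+ m).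
Proof.
move=> oU Cf; elim: m => [|m IH]; first exact: smooth_on_cst.
by apply: smooth_on_ext (smooth_onM oU Cf IH) => // x _; rewrite exprS.
Qed.

Lemma smooth_onV U f : open U -> (forall x, U x -> f x != 0) ->
  smooth_on U f -> smooth_on U (fun x => (f x)^-1).
Proof. by move=> oU f0 Cf k; exact: Ck_onV. Qed.

Lemma smooth_on_sum (I : Type) (r : seq I) (p : pred I) U (f : I -> V -> R) : open U ->
  (forall i, smooth_on U (f i)) -> smooth_on U (fun x => \sum_(i <- r | p i) f i x).
Proof.
move=> oU Cf; elim: r => [|i r IH].
  by apply: smooth_on_ext (smooth_on_cst U 0) => // x _; rewrite big_nil.
have [pi|pi] := boolP (p i).
  by apply: smooth_on_ext (smooth_onD oU (Cf i) IH) => // x _; rewrite big_cons pi.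
by apply: smooth_on_ext IH => // x _; rewrite big_cons (negbTE pi).
Qed.

Lemma smooth_on_prod (I : Type) (r : seq I) (p : pred I) U (f : I -> V -> R) : open U ->
  (forall i, smooth_on U (f i)) -> smooth_on U (fun x => \prod_(i <- r | p i) f i x).
Proof.
move=> oU Cf; elim: r => [|i r IH].
  by apply: smooth_on_ext (smooth_on_cst U 1) => // x _; rewrite big_nil.
have [pi|pi] := boolP (p i).
  by apply: smooth_on_ext (smooth_onM oU (Cf i) IH) => // x _; rewrite big_cons pi.
by apply: smooth_on_ext IH => // x _; rewrite big_cons (negbTE pi).
Qed.

Lemma smooth_on_derive U f v : smooth_on U f -> smooth_on U (fun x => 'D_v f x).
Proof. by move=> Cf k; have [_ /(_ v)[]] := Cf k.+1. Qed.

Lemma smooth_on_derivable U f v x : smooth_on U f -> U x -> derivable f x v.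
Proof. by move=> Cf; have [_ /(_ v)[+ _]] := Cf 1%N; apply. Qed.

Lemma smooth_on_continuous U f x : smooth_on U f -> U x -> {for x, continuous f}.
Proof. by move=> Cf; have [+ _] := Cf 0%N; apply. Qed.

Lemma smooth_on_det U m (A : V -> 'M[R]_m) : open U ->
  (forall i j, smooth_on U (fun x => A x i j)) -> smooth_on U (fun x => \det (A x)).
Proof.
move=> oU CA; apply: smooth_on_sum => // s.
apply: smooth_onM => //; first exact: smooth_on_cst.
by apply: smooth_on_prod.
Qed.

(** Cramer's rule: an entry of the inverse is a cofactor, polynomial in the entries, divided by the
    determinant. *)
Lemma smooth_on_invmx U m (A : V -> 'M[R]_m) i j : open U ->
  (forall x, U x -> A x \in unitmx) ->
  (forall i j, smooth_on U (fun x => A x i j)) -> smooth_on U (fun x => invmx (A x) i j).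
Proof.
move=> oU uA CA.
have Cadj : smooth_on U (fun x => \adj (A x) i j).
  apply: (@smooth_on_ext _ (fun x => (-1) ^+ (j + i) * \det (row' j (col' i (A x))))) => //.
    by move=> x _; rewrite mxE.
  apply: smooth_onM => //; first exact: smooth_on_cst.
  apply: smooth_on_det => // a b.
  by apply: smooth_on_ext (CA (lift j a) (lift i b)) => // x _; rewrite !mxE.
have Cdet : smooth_on U (fun x => (\det (A x))^-1).
  apply: smooth_onV => //; last exact: smooth_on_det.
  by move=> x /uA; rewrite unitmxE unitfE.
by apply: smooth_on_ext (smooth_onM oU Cdet Cadj) => // x Ux; rewrite /invmx uA// [RHS]mxE.
Qed.

End SmoothCalculus.

(** * Chain rule in two variables *)

Section ChainRule.
Context (R : realType).

(** The mean value theorem for increments of either sign. The intermediate point is located only by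
    its absolute value, which suffices to keep it inside a ball. *)
Lemma increment (g dg : R -> R) (h : R) :
  (forall c : R, `|c| <= `|h| -> is_derive c 1 g (dg c)) ->
  exists2 c, `|c| <= `|h| & g h - g 0 = dg c * h.
Proof.
move=> Dg; have [h0|/ltW h0] := leP 0 h.
  have Dg' (c : R) : c \in `[0, h] -> is_derive c 1 g (dg c).
    by rewrite in_itv/= => /andP[c0 ch]; apply: Dg; rewrite !ger0_norm.
  have Dgo (c : R) : c \in `]0, h[ -> is_derive c 1 g (dg c).
    by move=> ch; apply: Dg'; apply: subset_itv_oo_cc ch.
  have cg : {within `[0, h], continuous g}.
    by apply: derivable_within_continuous => c /Dg'[].
  have [c c0h ->] := MVT_segment h0 Dgo cg.
  exists c; last by rewrite subr0.
  by move: c0h; rewrite in_itv/= => /andP[c0 ch]; rewrite !ger0_norm.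
have Dg' (c : R) : c \in `[h, 0] -> is_derive c 1 g (dg c).
  by rewrite in_itv/= => /andP[c0 ch]; apply: Dg; rewrite !ler0_norm// lerN2.
have Dgo (c : R) : c \in `]h, 0[ -> is_derive c 1 g (dg c).
  by move=> ch; apply: Dg'; apply: subset_itv_oo_cc ch.
have cg : {within `[h, 0], continuous g}.
  by apply: derivable_within_continuous => c /Dg'[].
have [c c0h e] := MVT_segment h0 Dgo cg.
exists c; last by rewrite -opprB e sub0r mulrN opprK.
by move: c0h; rewrite in_itv/= => /andP[c0 ch]; rewrite !ler0_norm// lerN2.
Qed.

(** The candidate for a differential on the plane, with [a] and [b] the two partial derivatives; the
    linear structure registered below is what [diff_unique] needs. *)
Definition lin2 (a b : R) (h : R * R) : R := a * h.1 + b * h.2.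

Fact lin2_linear a b : linear (lin2 a b).
Proof. by move=> k [x y] [z t]; rewrite /lin2 /= /GRing.scale/=; ring. Qed.
HB.instance Definition _ a b :=
  GRing.isLinear.Build R (R * R)%type R *:%R (lin2 a b) (lin2_linear a b).

Lemma is_derive_line (V : normedModType R) (f : V -> R) (v w : V) (c : R) :
  derivable f (c *: v + w) v ->
  is_derive c 1 (fun t : R => f (t *: v + w)) ('D_v f (c *: v + w)).
Proof.
move=> df; have E : (fun h : R => h^-1 *: (((fun t : R => f (t *: v + w)) \o shift c) (h *: 1)
      - f (c *: v + w)))
    = (fun h => h^-1 *: ((f \o shift (c *: v + w)) (h *: v) - f (c *: v + w))).
  by apply/funext => h /=; rewrite addrA -scalerDl [_ *: 1]mulr1.
by apply: DeriveDef; rewrite /derivable /derive E.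
Qed.

(** [smooth_on] speaks of directional derivatives only, while the chain rule needs a differential.
    Going from p to p + (x, y) through p + (0, y), the mean value theorem on each edge expresses the
    increment by partial derivatives at nearby points, and by continuity these differ from those at
    p by less than e / 2. *)
Lemma C1_differentiable (U : set (R * R)) (f : R * R -> R) p :
  open U -> smooth_on U f -> U p ->
  differentiable f p /\ 'd f p = lin2 ('D_(1, 0) f p) ('D_(0, 1) f p) :> (_ -> _).
Proof.
move=> oU Cf Up.
set a := 'D_(1, 0) f p; set b := 'D_(0, 1) f p.
have clin : continuous (lin2 a b).
  move=> q; apply: cvgD; apply: cvgM; try exact: cvg_cst.
    exact: cvg_fst.
  exact: cvg_snd.
have flin : f \o shift p = cst (f p) + lin2 a b +o_ (0 : R * R) id.
  apply/eqaddoP => e e0.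
  have e20 : 0 < e / 2 by rewrite divr_gt0.
  have ca := smooth_on_continuous (smooth_on_derive ((1, 0) : R * R) Cf) Up.
  have cb := smooth_on_continuous (smooth_on_derive ((0, 1) : R * R) Cf) Up.
  have na : \forall q \near p, `|a - 'D_(1, 0) f q| < e / 2.
    by move/cvgrPdist_lt: ca => /(_ _ e20).
  have nb : \forall q \near p, `|b - 'D_(0, 1) f q| < e / 2.
    by move/cvgrPdist_lt: cb => /(_ _ e20).
  have /nbhs_ballP[d /= d0 Bd] : \forall q \near p, [/\ `|a - 'D_(1, 0) f q| < e / 2,
       `|b - 'D_(0, 1) f q| < e / 2 & U q].
    by apply: filterS3 na nb (open_nbhs_nbhs (conj oU Up)) => q.
  have inB q : `|q| < d -> [/\ `|a - 'D_(1, 0) f (q + p)| < e / 2,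
       `|b - 'D_(0, 1) f (q + p)| < e / 2 & U (q + p)].
    move=> qd; apply: Bd.
    by rewrite prod_norm_ball /ball_/= opprD addrCA subrr addr0 normrN.
  apply/nbhs_ballP; exists d => //= q.
  rewrite prod_norm_ball /ball_/= sub0r normrN => qd.
  case: q qd => x y xyd.
  have [xd yd] : `|x| <= `|(x, y)| /\ `|y| <= `|(x, y)|.
    by rewrite prod_normE/= !le_max !lexx orbT.
  (* The product norm is the maximum of the two norms, so both edges of the path stay in the
     ball. *)
  have Dx (c : R) : `|c| <= `|x| -> `|(c, y)| < d.
    move=> cx; apply: le_lt_trans xyd; rewrite !prod_normE /= ge_max.
    by rewrite !le_max cx lexx orbT.
  have Dy (c : R) : `|c| <= `|y| -> `|(0 : R, c)| < d.
    move=> cx; apply: le_lt_trans xyd; rewrite !prod_normE /= ge_max.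
    by rewrite !le_max cx normr0 normr_ge0 orbT.
  have ex (c : R) : c *: (1, 0) + ((0, y) + p) = (c, y) + p :> R * R.
    case: (p) => p1 p2; congr (_, _) => /=; rewrite /GRing.scale/=; ring.
  have ey (c : R) : c *: (0, 1) + p = (0, c) + p :> R * R.
    case: (p) => p1 p2; congr (_, _) => /=; rewrite /GRing.scale/=; ring.
  have [|c1 c1x] := @increment (fun t : R => f (t *: (1, 0) + ((0, y) + p)))
    (fun c : R => 'D_(1, 0) f (c *: (1, 0) + ((0, y) + p))) x.
    move=> c cx; apply: is_derive_line; rewrite ex.
    by apply: (smooth_on_derivable Cf); case: (inB _ (Dx _ cx)).
  have [|c2 c2y] := @increment (fun t : R => f (t *: (0, 1) + p))
    (fun c : R => 'D_(0, 1) f (c *: (0, 1) + p)) y.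
    move=> c cy; apply: is_derive_line; rewrite ey.
    by apply: (smooth_on_derivable Cf); case: (inB _ (Dy _ cy)).
  rewrite !ey !ex => e2 e1.
  have [/ltW Ha _ _] := inB _ (Dx _ c1x); have [_ /ltW Hb _] := inB _ (Dy _ c2y).
  rewrite -[X in `|X| <= _]/(f ((x, y) + p) - (f p + lin2 a b (x, y))).
  have -> : f ((x, y) + p) - (f p + lin2 a b (x, y)) =
    - ((a - 'D_(1, 0) f ((c1, y) + p)) * x + (b - 'D_(0, 1) f ((0, c2) + p)) * y).
    move: e1 e2; rewrite -[(0, 0) + p]/(0 + p) add0r /lin2/= => e1 e2.
    rewrite (_ : f ((x, y) + p) = 'D_(1, 0) f ((c1, y) + p) * x +
      'D_(0, 1) f ((0, c2) + p) * y + f p); last by rewrite -e1 -e2; ring.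
    ring.
  rewrite normrN (le_trans (ler_normD _ _))// !normrM [e]splitr mulrDl.
  by apply: lerD; apply: ler_pM.
have dE := diff_unique clin flin; split => //.
by apply/diff_locallyP; rewrite dE.
Qed.

(** Restricting to the line through [x] makes the chain rules available for inner functions that are
    only known to be derivable in the single direction [v]. *)
Lemma is_derive_along (V : normedModType R) (g : V -> R) (x v : V) (dg : R) :
  is_derive x v g dg <-> is_derive (0 : R) 1 (fun h : R => g (h *: v + x)) dg.
Proof.
set c := fun h : R => _.
have E : (fun h : R => h^-1 *: ((c \o shift 0) (h *: 1) - c 0))
    = (fun h => h^-1 *: ((g \o shift x) (h *: v) - g x)).
  by apply/funext => h; rewrite /c /= addr0 scale0r add0r [_%:A]mulr1.
by split=> -[D <-]; apply: DeriveDef; move: D; rewrite /derivable /derive E.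
Qed.

Lemma is_derive_comp1 (V : normedModType R) (f : R -> R) (a : V -> R) (x v : V)
    (df da : R) :
  is_derive (a x) 1 f df -> is_derive x v a da ->
  is_derive x v (fun z => f (a z)) (df * da).
Proof.
move=> [Df Ef] /is_derive_along[Da Ea]; apply/is_derive_along.
have a0 : a (0 *: v + x) = a x by rewrite scale0r add0r.
have Df' : derivable f (a (0 *: v + x)) 1 by rewrite a0.
apply: DeriveDef.
  by apply/derivable1_diffP; apply: differentiable_comp; apply/derivable1_diffP.
by rewrite -derive1E (derive1_comp Da Df') !derive1E Ea a0 Ef.
Qed.

(** On the line through [x] the inner pair is a differentiable curve in the plane, and [f] is
    differentiable by [C1_differentiable], so the chain rule for differentials applies. *)
Lemma is_derive_comp2 (V : normedModType R) (U : set (R * R)) (f : R * R -> R)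
    (a b : V -> R) (x v : V) (da db : R) :
  open U -> smooth_on U f -> U (a x, b x) ->
  is_derive x v a da -> is_derive x v b db ->
  is_derive x v (fun z => f (a z, b z))
    ('D_(1, 0) f (a x, b x) * da + 'D_(0, 1) f (a x, b x) * db).
Proof.
move=> oU Cf Uab /is_derive_along[/derivable1_diffP Da Ea].
move=> /is_derive_along[/derivable1_diffP Db Eb]; apply/is_derive_along.
have [df dfE] := C1_differentiable oU Cf Uab.
have x0 : 0 *: v + x = x by rewrite scale0r add0r.
have dab := differentiable_pair Da Db.
have df' : differentiable f (a (0 *: v + x), b (0 *: v + x)) by rewrite !x0.
have dfab := differentiable_comp dab df'.
apply: DeriveDef; first exact/derivable1_diffP.
rewrite -[fun h => f _]/(f \o (fun h => (a (h *: v + x), b (h *: v + x)))).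
rewrite deriveE// (diff_comp dab df') [LHS]/= (diff_pair Da Db).
by rewrite -(deriveE _ Da) -(deriveE _ Db) Ea Eb !x0 dfE.
Qed.

End ChainRule.

(** * Functions of (r, s) *)

Section Linear.
Context (R : realType) (V : normedModType R).

Lemma is_derive_linear (f : V -> R) x v : linear f -> continuous f ->
  is_derive x v f (f v).
Proof.
move=> lf cf; pose g : {linear V -> R} := HB.pack f (GRing.isLinear.Build R V R *:%R f lf).
have df : differentiable g x by exact: linear_differentiable.
apply: DeriveDef; first exact: diff_derivable.
by rewrite -[f]/(g : V -> R) deriveE// diff_lin.
Qed.

Lemma smooth_on_linear (U : set V) (f : V -> R) : linear f -> continuous f ->
  smooth_on U f.
Proof.
move=> lf cf [|k]; split => //; try by move=> x _; exact: cf.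
move=> v; split.
  by move=> x _; case: (is_derive_linear x v lf cf).
under [X in Ck_on _ _ X]eq_fun => x.
  have -> : 'D_v f x = f v by case: (is_derive_linear x v lf cf).
  over.
exact: Ck_on_cst.
Qed.

End Linear.

Section Profile.
Context (R : realType).
Implicit Types (W : set (R * R)) (f : R -> R -> R).

Definition smooth2 W f := smooth_on W (fun p => f p.1 p.2).

Lemma drE f r s : dr f r s = 'D_(1, 0) (fun p : R * R => f p.1 p.2) (r, s).
Proof.
rewrite /dr /derive1 /derive; set g1 := (fun h => _); set g2 := (fun h => _).
suff -> : g1 = g2 by [].
by apply/funext => h; rewrite /g1 /g2 /= [h *: 0]mulr0 add0r [h *: _]mulr1.
Qed.

Lemma dsE f r s : ds f r s = 'D_(0, 1) (fun p : R * R => f p.1 p.2) (r, s).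
Proof.
rewrite /ds /derive1 /derive; set g1 := (fun h => _); set g2 := (fun h => _).
suff -> : g1 = g2 by [].
by apply/funext => h; rewrite /g1 /g2 /= [h *: 0]mulr0 add0r [h *: _]mulr1.
Qed.

Lemma smooth2_dr W f : smooth2 W f -> smooth2 W (dr f).
Proof.
move=> Cf; rewrite /smooth2.
rewrite (_ : (fun p => _) = 'D_((1, 0) : R * R) (fun p => f p.1 p.2)).
  exact: smooth_on_derive Cf.
by apply/funext => -[r s]; rewrite drE.
Qed.

Lemma smooth2_ds W f : smooth2 W f -> smooth2 W (ds f).
Proof.
move=> Cf; rewrite /smooth2.
rewrite (_ : (fun p => _) = 'D_((0, 1) : R * R) (fun p => f p.1 p.2)).
  exact: smooth_on_derive Cf.
by apply/funext => -[r s]; rewrite dsE.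
Qed.

Lemma smooth2_fst W : smooth2 W (fun r _ => r).
Proof. by apply: smooth_on_linear => // x; exact: cvg_fst. Qed.

Lemma smooth2_snd W : smooth2 W (fun _ s => s).
Proof. by apply: smooth_on_linear => // x; exact: cvg_snd. Qed.

Lemma is_derive_profile (V : normedModType R) W f (a b : V -> R) x v da db :
  open W -> smooth2 W f -> W (a x, b x) ->
  is_derive x v a da -> is_derive x v b db ->
  is_derive x v (fun z => f (a z) (b z)) (dr f (a x) (b x) * da + ds f (a x) (b x) * db).
Proof. by move=> oW Cf Wab Da Db; rewrite drE dsE; exact: is_derive_comp2 Cf _ _ _. Qed.

Lemma is_derive_ds W f r s : open W -> smooth2 W f -> W (r, s) ->
  is_derive s 1 (f r) (ds f r s).
Proof.
move=> oW Cf Wrs.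
have := is_derive_profile oW Cf (Wrs : W (cst r s, id s)) (is_derive_cst r s 1)
  (is_derive_id s (1 : R)).
by rewrite mulr0 add0r mulr1.
Qed.

Lemma smooth2_continuous W f r s : open W -> smooth2 W f -> W (r, s) ->
  {for s, continuous (f r)}.
Proof.
move=> oW Cf Wrs; apply/differentiable_continuous/derivable1_diffP.
by case: (is_derive_ds oW Cf Wrs).
Qed.

Lemma open_neq0 W (f : R * R -> R) : open W -> smooth_on W f ->
  open (W `&` [set p | f p != 0]).
Proof.
move=> oW Cf; rewrite openE => p [Wp fp]; apply: filterI.
  exact: open_nbhs_nbhs.
exact: cvgr_neq0 (smooth_on_continuous Cf Wp) fp.
Qed.

(** * Smoothness of P and Q *)

Section SprayCoefficients.
Variables (W : set (R * R)) (phi : R -> R -> R).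
Hypotheses (oW : open W) (Cphi : smooth2 W phi).
Let T (r s : R) := phi r s - s * ds phi r s + (r ^+ 2 - s ^+ 2) * ds (ds phi) r s.

(** The points where none of the denominators r, phi and T occurring in P and Q vanishes. *)
Definition regular_domain : set (R * R) :=
  W `&` [set p | p.1 * phi p.1 p.2 * T p.1 p.2 != 0].

Local Ltac smooth := repeat first
  [ exact: smooth_on_cst | exact: smooth2_fst | exact: smooth2_snd
  | exact: Cphi | apply: smooth2_dr | apply: smooth2_ds | apply: smooth_onD => //
  | apply: smooth_onN => // | apply: smooth_onM => // | apply: smooth_onX => //].

Lemma smooth_den : smooth2 W T.
Proof. by rewrite /smooth2 /T; smooth. Qed.

Lemma open_regular_domain : open regular_domain.
Proof.
apply: open_neq0 => //; smooth; exact: smooth_den.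
Qed.

Let oD := open_regular_domain.
Let sub : regular_domain `<=` W. Proof. by move=> p []. Qed.

Lemma smooth_spray_Q : smooth2 regular_domain (spray_Q phi).
Proof.
rewrite /smooth2 /spray_Q; apply: smooth_onM => //.
  apply: smooth_onM => //; first exact: smooth_on_cst.
  apply: smooth_onV => //; last first.
    by apply: smooth_onM => //; [exact: smooth_on_cst|exact: smooth2_fst].
  by move=> p [_]/=; rewrite !mulf_eq0 !negb_or pnatr_eq0 => /andP[/andP[-> _] _].
apply: smooth_onM => //; first by apply: (smooth_on_sub sub); smooth.
apply: smooth_onV => //; last by apply: (smooth_on_sub sub); exact: smooth_den.
by move=> p [_]/=; rewrite !mulf_eq0 !negb_or => /andP[_ ].
Qed.

Lemma smooth_spray_P : smooth2 regular_domain (spray_P phi).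
Proof.
rewrite /smooth2 /spray_P.
have ne (p : R * R) : regular_domain p -> (p.1 != 0) && (phi p.1 p.2 != 0).
  by move=> [_]/=; rewrite !mulf_eq0 !negb_or => /andP[].
apply: smooth_onD => //; apply: smooth_onM => //.
- apply: smooth_onM => //; last by apply: (smooth_on_sub sub); smooth.
  apply: smooth_onN => //; apply: smooth_onM => //; first exact: smooth_on_cst.
  by apply: smooth_onV => //; [move=> p /ne/andP[]|exact: (smooth_on_sub sub)].
- exact: smooth_spray_Q.
- apply: smooth_onM => //; first exact: smooth_on_cst.
  apply: smooth_onV => //; last by apply: (smooth_on_sub sub); smooth.
  by move=> p /ne /andP[p1 p2]; rewrite !mulf_neq0// pnatr_eq0.
- by apply: (smooth_on_sub sub); smooth.
Qed.

End SprayCoefficients.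
End Profile.

(** * Derivatives of |x|, |y| and s *)

Section PointwiseRules.
Context (R : realType) (V : normedModType R).
Implicit Types (f g : V -> R) (x v : V).

(** This and the following rules restate differentiation rules with functions applied to a bound
    point, the shape on which [derive_step] matches. *)
Lemma is_derive_pcst (c : R) x v : is_derive x v (fun=> c) 0.
Proof. exact: is_derive_cst. Qed.

Lemma is_derive_padd f g x v df dg : is_derive x v f df -> is_derive x v g dg ->
  is_derive x v (fun z => f z + g z) (df + dg).
Proof. exact: is_deriveD. Qed.

Lemma is_derive_popp f x v df : is_derive x v f df ->
  is_derive x v (fun z => - f z) (- df).
Proof. exact: is_deriveN. Qed.

Lemma is_derive_pmul f g x v df dg : is_derive x v f df -> is_derive x v g dg ->
  is_derive x v (fun z => f z * g z) (f x * dg + g x * df).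
Proof. exact: is_deriveM. Qed.

Lemma is_derive_psqr f x v df : is_derive x v f df ->
  is_derive x v (fun z => f z ^+ 2) (2 * f x * df).
Proof.
move=> D; have := is_derive_pmul D D.
by rewrite (_ : _ + _ = 2 * f x * df); [|ring].
Qed.

Lemma is_derive_pinv f x v df : f x != 0 -> is_derive x v f df ->
  is_derive x v (fun z => (f z)^-1) (- (f x ^- 2) * df).
Proof. by move=> fx0 [Df <-]; apply: DeriveDef; [exact: derivableV|exact: deriveV]. Qed.

Lemma is_derive_psum n (f : 'I_n -> V -> R) x v (df : 'I_n -> R) :
  (forall i, is_derive x v (f i) (df i)) ->
  is_derive x v (fun z => \sum_(i < n) f i z) (\sum_(i < n) df i).
Proof.
by move=> Df; rewrite (_ : (fun z => _) = \sum_(i < n) f i);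
  [exact: is_derive_sum|apply/funext => z; rewrite fct_sumE].
Qed.

End PointwiseRules.

(** * The Euclidean inner product and norm *)

Section Euclidean.
Context (R : realType) (n : nat).
Implicit Types (x y z v w : 'rV[R]_n) (a : R).

Lemma dotC x y : dot x y = dot y x.
Proof. by apply: eq_bigr => i _; rewrite mulrC. Qed.

Lemma dotDl x y z : dot (x + y) z = dot x z + dot y z.
Proof. by rewrite -big_split; apply: eq_bigr => i _; rewrite mxE mulrDl. Qed.

Lemma dotZl a x z : dot (a *: x) z = a * dot x z.
Proof. by rewrite mulr_sumr; apply: eq_bigr => i _; rewrite mxE mulrA. Qed.

Lemma dot0l x : dot 0 x = 0.
Proof. by apply: big1 => i _; rewrite mxE mul0r. Qed.

Lemma dot0r x : dot x 0 = 0.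
Proof. by rewrite dotC dot0l. Qed.

Lemma dotDr x y z : dot z (x + y) = dot z x + dot z y.
Proof. by rewrite dotC dotDl !(dotC z). Qed.

Lemma dotZr a x z : dot z (a *: x) = a * dot z x.
Proof. by rewrite dotC dotZl dotC. Qed.

Lemma dot_ge0 x : 0 <= dot x x.
Proof. by apply: sumr_ge0 => i _; rewrite -expr2 sqr_ge0. Qed.

Lemma dot_eq0 x : (dot x x == 0) = (x == 0).
Proof.
apply/eqP/eqP => [/psumr_eq0P x0|->]; last by rewrite dot0l.
apply/rowP => i; apply/eqP; rewrite mxE -[_ == _]orbb -mulf_eq0 x0// => j _.
by rewrite -expr2 sqr_ge0.
Qed.

Lemma dot_gt0 x : x != 0 -> 0 < dot x x.
Proof. by rewrite lt_def dot_ge0 dot_eq0 andbT. Qed.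

Lemma dot_delta x j : dot (delta_mx 0 j) x = x 0 j.
Proof.
rewrite /dot (bigD1 j)//= big1 ?addr0 => [|i ij]; first by rewrite mxE !eqxx mul1r.
by rewrite mxE (negbTE ij) andbF mul0r.
Qed.

Lemma enorm_gt0 x : x != 0 -> 0 < enorm x.
Proof. by move=> x0; rewrite sqrtr_gt0 dot_gt0. Qed.

Lemma sqr_enorm x : enorm x ^+ 2 = dot x x.
Proof. by rewrite sqr_sqrtr ?dot_ge0. Qed.

(** For y nonzero, the vector <y,y> x - <x,y> y has squared norm <y,y> (<x,x><y,y> - <x,y>^2), which
    is nonnegative. *)
Lemma cauchy_schwarz x y : `|dot x y| <= enorm x * enorm y.
Proof.
have [->|y0] := eqVneq y 0.
  by rewrite dot0r normr0 mulr_ge0 ?sqrtr_ge0.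
rewrite -[leRHS]ger0_norm ?mulr_ge0 ?sqrtr_ge0// -ler_sqr ?nnegrE// !real_normK ?num_real//.
rewrite exprMn !sqr_enorm.
have := dot_ge0 (dot y y *: x - dot x y *: y).
rewrite -scaleNr dotDl !dotDr !dotZl !dotZr (dotC y x).
rewrite (_ : _ + _ = dot y y * (dot x x * dot y y - dot x y ^+ 2)); last by ring.
by rewrite pmulr_rge0 ?dot_gt0// subr_ge0.
Qed.

Lemma coord_linear i : linear (fun z : 'rV[R]_n => z 0 i).
Proof. by move=> a x y; rewrite !mxE. Qed.

Lemma is_derive_coord x v i : is_derive x v (fun z : 'rV[R]_n => z 0 i) (v 0 i).
Proof.
apply: (is_derive_linear x v (coord_linear i)); exact: coord_continuous.
Qed.

Lemma is_derive_dot x v (f g : 'rV[R]_n -> 'rV[R]_n) (df dg : 'rV[R]_n) :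
  (forall i, is_derive x v (fun z => f z 0 i) (df 0 i)) ->
  (forall i, is_derive x v (fun z => g z 0 i) (dg 0 i)) ->
  is_derive x v (fun z => dot (f z) (g z)) (dot (f x) dg + dot (g x) df).
Proof.
move=> Df Dg; rewrite /dot -big_split.
by apply: is_derive_psum => i; exact: is_derive_pmul.
Qed.

Lemma is_derive_enorm x v : x != 0 -> is_derive x v (@enorm R n) (dot x v / enorm x).
Proof.
move=> x0; have d0 := dot_gt0 x0.
have D : is_derive x v (fun z => dot z z) (dot x v + dot x v).
  by apply: is_derive_dot => i; exact: is_derive_coord.
have Ds : is_derive (dot x x) 1 Num.sqrt (2 * enorm x)^-1 by exact: is_derive1_sqrt.
have := is_derive_comp1 (a := fun z => dot z z) Ds D.
rewrite (_ : (2 * enorm x)^-1 * _ = dot x v / enorm x)//.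
by field; rewrite gt_eqF// enorm_gt0.
Qed.

End Euclidean.

Section Radial.
Context (R : realType) (n : nat).
Implicit Types (x y v : 'rV[R]_n) (f : R -> R -> R).

Definition sphs x y : R := dot x y / enorm y.
Definition radial f x y : R := f (enorm x) (sphs x y).

Variables (Omega : set 'rV[R]_n) (W : set (R * R)).
Hypotheses (oW : open W) (OW : rs_domain Omega `<=` W).

Lemma rs_domain_sphs x y : Omega x -> x != 0 -> y != 0 ->
  rs_domain Omega (enorm x, sphs x y).
Proof.
move=> Ox x0 y0; split => /=; [by exists x|exact: enorm_gt0|].
rewrite normrM [X in _ * X]ger0_norm ?invr_ge0 ?sqrtr_ge0//.
by rewrite ler_pdivrMr ?enorm_gt0// cauchy_schwarz.
Qed.

Section At.
Variables (x y : 'rV[R]_n).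
Hypotheses (Ox : Omega x) (x0 : x != 0) (y0 : y != 0).

Lemma is_derive_enorm_coord j :
  is_derive y (delta_mx 0 j) (@enorm R n) (y 0 j / enorm y).
Proof. by rewrite -dot_delta dotC; exact: is_derive_enorm. Qed.

Lemma is_derive_sphs_x j :
  is_derive x (delta_mx 0 j) (fun z => sphs z y) (y 0 j / enorm y).
Proof.
have D : is_derive x (delta_mx 0 j) (fun z => dot z y) (dot x 0 + dot y (delta_mx 0 j)).
  apply: is_derive_dot => i; first exact: is_derive_coord.
  rewrite mxE; exact: is_derive_cst.
have := is_derive_pmul D (is_derive_pcst (enorm y)^-1 x (delta_mx 0 j)).
rewrite (_ : _ + _ = y 0 j / enorm y)//.
by rewrite mulr0 add0r dot0r add0r dotC dot_delta mulrC.
Qed.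

Lemma is_derive_sphs_y j :
  is_derive y (delta_mx 0 j) (sphs x)
    (x 0 j / enorm y - sphs x y * y 0 j / enorm y ^+ 2).
Proof.
have D : is_derive y (delta_mx 0 j) (fun z => dot x z) (dot x (delta_mx 0 j) + dot y 0).
  apply: is_derive_dot => i; last exact: is_derive_coord.
  rewrite mxE; exact: is_derive_cst.
have u0 : enorm y != 0 by rewrite gt_eqF// enorm_gt0.
have := is_derive_pmul D (is_derive_pinv u0 (is_derive_enorm_coord j)).
rewrite dot0r addr0 (dotC x (delta_mx 0 j)) dot_delta.
rewrite (_ : _ + _ = x 0 j / enorm y - sphs x y * y 0 j / enorm y ^+ 2)//.
by rewrite /sphs; field.
Qed.

Lemma is_derive_radial_x f j : smooth2 W f ->
  is_derive x (delta_mx 0 j) (fun z => radial f z y)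
    (radial (dr f) x y * (x 0 j / enorm x) + radial (ds f) x y * (y 0 j / enorm y)).
Proof.
move=> Cf; apply: (is_derive_profile oW Cf).
- by apply: OW; exact: rs_domain_sphs.
- by rewrite -dot_delta dotC; exact: is_derive_enorm.
- exact: is_derive_sphs_x.
Qed.

Lemma is_derive_radial_y f j : smooth2 W f ->
  is_derive y (delta_mx 0 j) (radial f x)
    (radial (ds f) x y * (x 0 j / enorm y - sphs x y * y 0 j / enorm y ^+ 2)).
Proof.
(* Since r does not depend on y, the r-term of the two-variable chain rule is zero; it is put back
   to match [is_derive_profile]. *)
move=> Cf; rewrite -[X in is_derive _ _ _ X]add0r.
rewrite -[X in is_derive _ _ _ (X + _)](mulr0 (radial (dr f) x y)).
apply: (is_derive_profile (a := fun=> enorm x) oW Cf).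
- by apply: OW; exact: rs_domain_sphs.
- exact: is_derive_sphs_y.
Qed.

End At.
End Radial.

(** * The fundamental tensor *)

Section Coordinates.
Context (R : realType) (n : nat).
Implicit Types (x y : 'rV[R]_n) (f : 'rV[R]_n -> 'rV[R]_n -> R) (g : 'rV[R]_n -> R).

Lemma is_derive_coordE x i j :
  is_derive x (delta_mx 0 j) (fun z : 'rV[R]_n => z 0 i) (i == j)%:R.
Proof. by have := is_derive_coord x (delta_mx 0 j) i; rewrite mxE eqxx. Qed.

Lemma near_neq0 x : x != 0 -> \forall z \near x, z != 0.
Proof. move=> x0; exact: (@cvgr_neq0 R _ _ (nbhs x) _ (fun z : 'rV[R]_n => z) x cvg_id x0). Qed.

(** Derivatives are local, so a closed form valid only on [Omega] away from 0 can be differentiated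
    in place of [f]. *)
Lemma dxE (Omega : set 'rV[R]_n) f g x y k d : open Omega -> Omega x -> x != 0 ->
  (forall z, Omega z -> z != 0 -> f z y = g z) -> is_derive x (delta_mx 0 k) g d ->
  dx k f x y = d.
Proof.
move=> oO Ox x0 fg [_ <-]; apply: near_eq_derive.
by apply: filterS2 (near_neq0 x0) (open_nbhs_nbhs (conj oO Ox)) => z z0 Oz; exact: fg.
Qed.

Lemma dyE f g x y k d : y != 0 ->
  (forall z, z != 0 -> f x z = g z) -> is_derive y (delta_mx 0 k) g d ->
  dy k f x y = d.
Proof.
by move=> y0 fg [_ <-]; apply: near_eq_derive; apply: filterS (near_neq0 y0).
Qed.

(** All sums over k in the spray and curvature computations contract expressions built from x, y and
    Kronecker deltas. Evaluating them once and for all leaves identities in <x,x>, <x,y>, <y,y> and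
    the coordinates with indices i and j. *)
Lemma sum_contraction x y (g h : 'I_n -> R) i j (a b c d a' b' c' : R) :
  (forall k, g k = a * x 0 k + b * y 0 k + c * (i == k)%:R + d * (k == j)%:R) ->
  (forall k, h k = a' * x 0 k + b' * y 0 k + c' * (k == j)%:R) ->
  \sum_(k < n) g k * h k =
    a * a' * dot x x + (a * b' + b * a') * dot x y + b * b' * dot y y
    + c * (a' * x 0 i + b' * y 0 i + c' * (i == j)%:R)
    + d * (a' * x 0 j + b' * y 0 j + c') + c' * (a * x 0 j + b * y 0 j).
Proof.
move=> gE hE.
have S1 (l : 'I_n) (e : 'I_n -> R) : \sum_(k < n) (k == l)%:R * e k = e l.
  rewrite (bigD1 l)//= eqxx mul1r big1 ?addr0// => k kl.
  by rewrite (negbTE kl) mul0r.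
rewrite (eq_bigr (fun k => a * a' * (x 0 k * x 0 k) + (a * b' + b * a') * (x 0 k * y 0 k)
   + b * b' * (y 0 k * y 0 k)
   + (k == i)%:R * (c * (a' * x 0 k + b' * y 0 k + c' * (k == j)%:R))
   + (k == j)%:R * (d * (a' * x 0 k + b' * y 0 k + c' * (k == j)%:R)
        + c' * (a * x 0 k + b * y 0 k)))); last first.
  by move=> k _; rewrite gE hE (eq_sym i k); ring.
by rewrite !big_split/= -!mulr_sumr !S1 eqxx -[nat_of_bool true]/1%N /dot; ring.
Qed.

Lemma sum_contractionC x y (g h : 'I_n -> R) i j (a b c d a' b' c' : R) :
  (forall k, g k = a * x 0 k + b * y 0 k + c * (i == k)%:R + d * (k == j)%:R) ->
  (forall k, h k = a' * x 0 k + b' * y 0 k + c' * (k == j)%:R) ->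
  \sum_(k < n) h k * g k =
    a * a' * dot x x + (a * b' + b * a') * dot x y + b * b' * dot y y
    + c * (a' * x 0 i + b' * y 0 i + c' * (i == j)%:R)
    + d * (a' * x 0 j + b' * y 0 j + c') + c' * (a * x 0 j + b * y 0 j).
Proof.
by move=> gE hE; rewrite -(sum_contraction gE hE); apply: eq_bigr => k _; rewrite mulrC.
Qed.

End Coordinates.

Lemma dot_sphs (R : realType) (n : nat) (x y : 'rV[R]_n) : y != 0 ->
  dot x y = sphs x y * enorm y.
Proof. by move=> y0; rewrite /sphs divfK// gt_eqF// enorm_gt0. Qed.

Definition gform (R : realType) (n : nat) (F : 'rV[R]_n -> 'rV[R]_n -> R)
    (x y v w : 'rV[R]_n) : R :=
  \sum_(i < n) \sum_(j < n) fundamental_tensor F x y i j * v 0 i * w 0 j.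

(* notypeclasses: otherwise the premises are closed by the library instances,
   whose derivatives have a different shape. *)
Ltac derive_step extra :=
  first [ extra
  | lazymatch goal with
    | |- is_derive ?x ?v (fun z => @?f z + @?g z) _ =>
        notypeclasses refine (@is_derive_padd _ _ f g x v _ _ _ _)
    | |- is_derive ?x ?v (fun z => @?f z * @?g z) _ =>
        notypeclasses refine (@is_derive_pmul _ _ f g x v _ _ _ _)
    | |- is_derive ?x ?v (fun z => - @?f z) _ =>
        notypeclasses refine (@is_derive_popp _ _ f x v _ _)
    | |- is_derive ?x ?v (fun z => @?f z ^+ 2) _ =>
        notypeclasses refine (@is_derive_psqr _ _ f x v _ _)
    | |- is_derive ?x ?v (fun z => (@?f z)^-1) _ =>
        notypeclasses refine (@is_derive_pinv _ _ f x v _ _ _)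
    | |- is_derive ?x ?v (fun z => ?c) _ => notypeclasses refine (is_derive_pcst c x v)
    end ].

(* The ring tactics compare atoms up to conversion, which is very slow on
   derivatives; making these atoms variables avoids this. *)
Ltac generalize_radial :=
  repeat match goal with
  | |- context [radial ?f ?x ?y] =>
    let p := fresh "p" in generalize (radial f x y); intro p
  end.

Section Metric.
Context (R : realType) (n : nat).
Variables (Omega : set 'rV[R]_n) (W : set (R * R)) (phi : R -> R -> R)
  (F : 'rV[R]_n -> 'rV[R]_n -> R).
Hypotheses (oO : open Omega) (oW : open W) (OW : rs_domain Omega `<=` W)
  (Cphi : smooth2 W phi)
  (FE : forall x y, Omega x -> y != 0 -> F x y = enorm y * radial phi x y).

Section At.
Variables (x : 'rV[R]_n).
Hypotheses (Ox : Omega x) (x0 : x != 0).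

Lemma dy_sqrF i y : y != 0 -> dy i (sqrF F) x y =
  2 * (radial phi x y ^+ 2 * y 0 i + radial phi x y * radial (ds phi) x y *
    (enorm y * x 0 i - sphs x y * y 0 i)).
Proof.
move=> y0; have u0 : enorm y != 0 by rewrite gt_eqF// enorm_gt0.
apply: (@dyE _ _ _ (fun z => (enorm z * radial phi x z) ^+ 2)) => //.
  by move=> z z0; rewrite /sqrF FE.
notypeclasses refine (is_derive_eq _ _).
  repeat derive_step ltac:(first [notypeclasses refine (is_derive_enorm_coord y0 _)
    | notypeclasses refine (is_derive_radial_y oW OW Ox x0 y0 _ Cphi)]).
by cbv beta; field.
Qed.

Lemma fundamental_tensorE y i j : y != 0 ->
  fundamental_tensor F x y i j =
   radial phi x y * (radial phi x y - sphs x y * radial (ds phi) x y) * (i == j)%:R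
   + (radial (ds phi) x y ^+ 2 + radial phi x y * radial (ds (ds phi)) x y)
      * (x 0 i - sphs x y * y 0 i / enorm y) * (x 0 j - sphs x y * y 0 j / enorm y)
   + radial phi x y * radial (ds phi) x y *
     ((x 0 i * y 0 j + y 0 i * x 0 j) / enorm y - sphs x y * y 0 i * y 0 j / enorm y ^+ 2).
Proof.
move=> y0; have u0 : enorm y != 0 by rewrite gt_eqF// enorm_gt0.
rewrite mxE; set D := (X in _ = X).
suff -> : dy j (dy i (sqrF F)) x y = 2 * D by rewrite mulKf// pnatr_eq0.
apply: (dyE y0 (fun z z0 => dy_sqrF i z0)).
notypeclasses refine (is_derive_eq _ _).
  repeat derive_step ltac:(first [notypeclasses refine (is_derive_enorm_coord y0 _)
    | notypeclasses refine (is_derive_sphs_y x y0 _)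
    | notypeclasses refine (is_derive_coordE y _ _)
    | notypeclasses refine (is_derive_radial_y oW OW Ox x0 y0 _ Cphi)
    | notypeclasses refine (is_derive_radial_y oW OW Ox x0 y0 _ (smooth2_ds Cphi))]).
by cbv beta; rewrite /D; field.
Qed.

Lemma gformE y v w : y != 0 ->
  gform F x y v w =
   radial phi x y * (radial phi x y - sphs x y * radial (ds phi) x y) * dot v w
   + (radial (ds phi) x y ^+ 2 + radial phi x y * radial (ds (ds phi)) x y)
      * (dot x v - sphs x y * dot y v / enorm y) * (dot x w - sphs x y * dot y w / enorm y)
   + radial phi x y * radial (ds phi) x y *
     ((dot x v * dot y w + dot y v * dot x w) / enorm y
       - sphs x y * dot y v * dot y w / enorm y ^+ 2).
Proof.
move=> y0; have u0 : enorm y != 0 by rewrite gt_eqF// enorm_gt0.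
set al := radial (ds phi) x y ^+ 2 + _; set ga := radial phi x y * radial (ds phi) x y.
set be := radial phi x y * (_ - _).
have S (a b : 'rV[R]_n) : \sum_(i < n) \sum_(j < n) (a 0 i * v 0 i) * (b 0 j * w 0 j) =
    dot a v * dot b w by rewrite /dot big_distrlr.
have D : \sum_(i < n) \sum_(j < n) (i == j)%:R * (v 0 i * w 0 j) = dot v w.
  apply: eq_bigr => i _; rewrite (bigD1 i)//= eqxx mul1r big1 ?addr0// => j ij.
  by rewrite eq_sym (negbTE ij) mul0r.
pose u := enorm y; pose s := sphs x y.
transitivity (be * dot v w + al * (dot x v * dot x w)
  + (ga - al * s) / u * (dot x v * dot y w) + (ga - al * s) / u * (dot y v * dot x w)
  + (al * s ^+ 2 - ga * s) / u ^+ 2 * (dot y v * dot y w)); last first.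
  by rewrite /u /s; field.
rewrite -!S -D !mulr_sumr -!big_split/=; apply: eq_bigr => i _.
rewrite !mulr_sumr -!big_split/=; apply: eq_bigr => j _.
by rewrite fundamental_tensorE// -/al -/be -/ga /u /s; field.
Qed.

Lemma dx_sqrF y k : y != 0 -> dx k (sqrF F) x y =
  2 * enorm y * radial phi x y * (enorm y * radial (dr phi) x y * (x 0 k / enorm x)
     + radial (ds phi) x y * y 0 k).
Proof.
move=> y0; have u0 : enorm y != 0 by rewrite gt_eqF// enorm_gt0.
have r0 : enorm x != 0 by rewrite gt_eqF// enorm_gt0.
apply: (@dxE _ _ _ _ (fun z => (enorm y * radial phi z y) ^+ 2) x y k _ oO Ox x0) => //.
  by move=> z z0 Oz; rewrite /sqrF FE.
notypeclasses refine (is_derive_eq _ _).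
  repeat derive_step ltac:(notypeclasses refine (is_derive_radial_x oW OW Ox x0 y0 _ Cphi)).
by cbv beta; field; rewrite u0 r0.
Qed.

(** The terms are grouped by x_k, y_k and the two deltas, as [sum_contraction] expects; hence the
    term with coefficient 0. *)
Lemma dydx_sqrF y k l : y != 0 -> dy l (dx k (sqrF F)) x y =
  (4 * y 0 l * radial phi x y * radial (dr phi) x y
    + 2 * (radial (ds phi) x y * radial (dr phi) x y
            + radial phi x y * radial (ds (dr phi)) x y)
        * (enorm y * x 0 l - sphs x y * y 0 l)) / enorm x * x 0 k
  + (2 * y 0 l / enorm y * radial phi x y * radial (ds phi) x y
     + 2 * (radial (ds phi) x y ^+ 2 + radial phi x y * radial (ds (ds phi)) x y)
        * (x 0 l - sphs x y * y 0 l / enorm y)) * y 0 k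
  + 0 * (l == k)%:R
  + 2 * enorm y * radial phi x y * radial (ds phi) x y * (k == l)%:R.
Proof.
move=> y0; have u0 : enorm y != 0 by rewrite gt_eqF// enorm_gt0.
have r0 : enorm x != 0 by rewrite gt_eqF// enorm_gt0.
apply: (dyE y0 (fun z z0 => dx_sqrF k z0)); set a := x 0 k / enorm x.
notypeclasses refine (is_derive_eq _ _).
  repeat derive_step ltac:(first [notypeclasses refine (is_derive_enorm_coord y0 _)
    | notypeclasses refine (is_derive_coordE y _ _)
    | notypeclasses refine (is_derive_radial_y oW OW Ox x0 y0 _ Cphi)
    | notypeclasses refine (is_derive_radial_y oW OW Ox x0 y0 _ (smooth2_dr Cphi))
    | notypeclasses refine (is_derive_radial_y oW OW Ox x0 y0 _ (smooth2_ds Cphi))]).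
rewrite /a; cbv beta; generalize_radial.
by field; rewrite u0 r0.
Qed.

End At.
End Metric.

(** * The spray *)

Section Geometry.
Context (R : realType) (n : nat).
Implicit Types (x y v w : 'rV[R]_n).

Lemma mulmx_dot v x : (v *m x^T) 0 0 = dot v x.
Proof. by rewrite mxE; apply: eq_bigr => i _; rewrite mxE. Qed.

(** The matrix with columns x and y has rank at most 2 < n, so its left kernel is nonzero. *)
Lemma exists_orthogonal (hn : (2 < n)%N) x y :
  exists w, [/\ w != 0, dot x w = 0 & dot y w = 0].
Proof.
pose A := (col_mx x y)^T.
have : kermx A != 0.
  rewrite kermx_eq0 /row_free neq_ltn (leq_ltn_trans _ hn)//.
  exact: rank_leq_col.
case/rowV0Pn => w /sub_kermxP wA w0; exists w.
have : row_mx (w *m x^T) (w *m y^T) = row_mx 0 0 by rewrite -mul_mx_row -tr_col_mx wA row_mx0.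
move=> /eq_row_mx[wx wy]; split => //.
  by rewrite dotC -mulmx_dot wx mxE.
by rewrite dotC -mulmx_dot wy mxE.
Qed.

(** Lets the pointwise results at (x, y) be read as statements about every pair (r, s). The vector y
    is taken in the plane of x and some z orthogonal to x. *)
Lemma rs_domain_realized (hn : (2 < n)%N) (Omega : set 'rV[R]_n) (r s : R) :
  rs_domain Omega (r, s) ->
  exists x y, [/\ Omega x, x != 0, y != 0, enorm x = r & sphs x y = s].
Proof.
case=> -[x Ox /= <-] r0 sr.
have x0 : x != 0.
  apply/eqP => x0; exfalso; move: r0; by rewrite x0 /enorm dot0l sqrtr0 ltxx.
have [z [z0 xz _]] := exists_orthogonal hn x x.
have r2 : 0 < enorm x ^+ 2 by rewrite exprn_gt0.
have s2 : 0 <= enorm x ^+ 2 - s ^+ 2.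
  by rewrite subr_ge0 -(real_normK (num_real s)) ler_sqr ?nnegrE ?normr_ge0// ltW.
(* This makes |c z|^2 = (r^2 - s^2) r^2, whence |y|^2 = r^4; as <x,y> = s r^2, the quotient
   <x,y>/|y| is s. *)
pose c := Num.sqrt (enorm x ^+ 2 - s ^+ 2) * enorm x / enorm z.
pose y := s *: x + c *: z.
have zn := enorm_gt0 z0.
have yy : dot y y = enorm x ^+ 4.
  rewrite /y dotDl !dotDr !dotZl !dotZr xz (dotC z) xz -!sqr_enorm.
  rewrite /c !expr2 -/(GRing.exp _ 2).
  have := sqr_sqrtr s2; move: (Num.sqrt _) => q qE.
  apply: (@mulfI _ (enorm z ^+ 2)); first by rewrite gt_eqF// exprn_gt0.
  transitivity (enorm z ^+ 2 * (s ^+ 2 * enorm x ^+ 2 + q ^+ 2 * enorm x ^+ 2)).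
    by field; rewrite gt_eqF.
  by rewrite qE; ring.
have ye : enorm y = enorm x ^+ 2.
  rewrite /enorm yy -/(enorm x) (_ : _ ^+ 4 = (enorm x ^+ 2) ^+ 2); last by rewrite -exprM.
  by rewrite sqrtr_sqr ger0_norm// ltW.
exists x, y; split => //.
  by rewrite -dot_eq0 yy expf_neq0// gt_eqF.
rewrite /sphs ye /y dotDr !dotZr xz mulr0 addr0 -sqr_enorm mulfK//.
by rewrite gt_eqF.
Qed.

Lemma gform_mx (F : 'rV[R]_n -> 'rV[R]_n -> R) x y v w :
  (v *m fundamental_tensor F x y *m w^T) 0 0 = gform F x y v w.
Proof.
rewrite mxE /gform exchange_big/=; apply: eq_bigr => j _.
by rewrite !mxE mulr_suml; apply: eq_bigr => i _; rewrite (mulrC (v 0 i)).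
Qed.

End Geometry.

(** * The denominators of P and Q do not vanish *)

Section RegularDomain.
Context (R : realType) (n : nat).
Variables (Omega : set 'rV[R]_n) (W : set (R * R)) (phi : R -> R -> R)
  (F : 'rV[R]_n -> 'rV[R]_n -> R).
Hypotheses (oO : open Omega) (oW : open W) (OW : rs_domain Omega `<=` W)
  (Cphi : smooth2 W phi)
  (FE : forall x y, Omega x -> y != 0 -> F x y = enorm y * radial phi x y)
  (phi_gt0 : forall r s, rs_domain Omega (r, s) -> 0 < phi r s)
  (F_pd : forall x y v, Omega x -> y != 0 -> v != 0 -> 0 < gform F x y v v).

(* For |s| < r the test vector is the component of x orthogonal to y for the
   fundamental tensor itself; for |s| = r it is any vector orthogonal to x, y. *)
Lemma rs_domain_regular (hn : (2 < n)%N) : rs_domain Omega `<=` regular_domain W phi.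
Proof.
move=> [r s] rsD; split; first exact: OW.
have phi0 := phi_gt0 rsD.
have [x [y [Ox x0 y0 xr ys]]] := rs_domain_realized hn rsD.
have r0 : 0 < r by case: rsD.
have u0 := enorm_gt0 y0.
rewrite /= -mulrA !mulf_neq0 ?gt_eqF//.
have G v w := gformE oW OW Cphi FE Ox x0 v w y0.
rewrite /radial xr ys in G.
have [rs|rs] := eqVneq (r ^+ 2 - s ^+ 2) 0.
  have [w [w0 xw yw]] := exists_orthogonal hn x y.
  have := F_pd Ox y0 w0; rewrite G xw yw rs !(mulr0, mul0r, subr0, addr0).
  by rewrite pmulr_lgt0 ?dot_gt0// pmulr_rgt0.
(* Here e is the Euclidean component of x orthogonal to y, and l is the solution of g(y, e + l y) =
   0. Then g(v, v) = phi (r^2 - s^2) T, so positivity of g gives that of T. *)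
set T := _ + _; pose l := - (ds phi r s * (r ^+ 2 - s ^+ 2)) / (enorm y * phi r s).
pose e := x + (- (s / enorm y)) *: y; pose v := e + l *: y.
have xy : dot x y = s * enorm y by rewrite -ys dot_sphs.
have ye : dot y e = 0.
  by rewrite /e dotDr dotZr (dotC y x) xy -sqr_enorm; field; rewrite gt_eqF.
have xe : dot x e = r ^+ 2 - s ^+ 2.
  by rewrite /e dotDr dotZr xy -sqr_enorm xr; field; rewrite gt_eqF.
have ee : dot e e = r ^+ 2 - s ^+ 2.
  by rewrite {1}/e dotDl dotZl xe ye mulr0 addr0.
have v0 : v != 0.
  have ve : dot v e = r ^+ 2 - s ^+ 2 by rewrite dotDl dotZl ee ye mulr0 addr0.
  by apply: contra rs => /eqP v0; rewrite -ve v0 dot0l.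
have yv : dot y v = l * enorm y ^+ 2 by rewrite /v dotDr ye dotZr add0r sqr_enorm.
have xv : dot x v = r ^+ 2 - s ^+ 2 + l * (s * enorm y) by rewrite /v dotDr xe dotZr xy.
have vv : dot v v = r ^+ 2 - s ^+ 2 + l ^+ 2 * enorm y ^+ 2.
  by rewrite {1}/v dotDl dotZl yv /v dotDr dotZr ee (dotC e) ye; ring.
have := F_pd Ox y0 v0; rewrite G yv xv vv.
rewrite (_ : _ + _ = (phi r s * (r ^+ 2 - s ^+ 2)) * T).
  by rewrite pmulr_rgt0// mulr_gt0// lt_def rs -ee dot_ge0.
rewrite /T /l; move: (ds phi r s) (ds (ds phi) r s) (phi r s) phi0 (enorm y) u0.
by move=> p1 p2 p p0 u uu; field; rewrite !gt_eqF.
Qed.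

End RegularDomain.

(** * Closed form of the spray coefficients *)

Section Spray.
Context (R : realType) (n : nat).
Variables (Omega : set 'rV[R]_n) (U : set (R * R)) (phi : R -> R -> R)
  (F : 'rV[R]_n -> 'rV[R]_n -> R).
Hypotheses (oO : open Omega) (oU : open U) (OW : rs_domain Omega `<=` regular_domain U phi)
  (Cphi : smooth2 U phi)
  (FE : forall x y, Omega x -> y != 0 -> F x y = enorm y * radial phi x y)
  (F_pd : forall x y v, Omega x -> y != 0 -> v != 0 -> 0 < gform F x y v v).

Let OU : rs_domain Omega `<=` U. Proof. by move=> p /OW[]. Qed.

(** A nonzero kernel vector v would satisfy g(v, v) = 0, against positive definiteness. *)
Lemma fundamental_tensor_unit x y : Omega x -> y != 0 ->
  fundamental_tensor F x y \in unitmx.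
Proof.
move=> Ox y0; rewrite -row_free_unit -kermx_eq0.
apply: contraT => /rowV0Pn[v /sub_kermxP vg v0].
by have := F_pd Ox y0 v0; rewrite -gform_mx vg mul0mx mxE ltxx.
Qed.

(** The inverse of g is never computed: it is enough to check that g applied to the claimed vector
    gives the bracket in the definition of the spray, up to the factor 4. *)
Lemma sprayE x y i : Omega x -> x != 0 -> y != 0 ->
  spray F i x y = enorm y * radial (spray_P phi) x y * y 0 i
    + enorm y ^+ 2 * radial (spray_Q phi) x y * x 0 i.
Proof.
move=> Ox x0 y0.
have u0 : enorm y != 0 by rewrite gt_eqF// enorm_gt0.
have r0 : enorm x != 0 by rewrite gt_eqF// enorm_gt0.
pose G : 'rV[R]_n := (enorm y * radial (spray_P phi) x y) *: y
    + (enorm y ^+ 2 * radial (spray_Q phi) x y) *: x.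
have key l : \sum_(k < n) dy l (dx k (sqrF F)) x y * y 0 k - dx l (sqrF F) x y =
    4 * gform F x y (delta_mx 0 l) G.
  have hy k : y 0 k = 0 * x 0 k + 1 * y 0 k + 0 * (k == l)%:R by ring.
  rewrite (sum_contraction (fun k => dydx_sqrF oO oU OU Cphi FE Ox x0 k l y0) hy).
  rewrite (dx_sqrF oO oU OU Cphi FE Ox x0 l y0).
  rewrite (gformE oU OU Cphi FE Ox x0 _ _ y0).
  rewrite !dot_delta (dotC x (delta_mx _ _)) (dotC y (delta_mx _ _)) !dot_delta.
  rewrite /G !mxE !dotDr !dotZr (dotC y x) (dot_sphs x y0) -!sqr_enorm.
  have [_ /=] := OW (rs_domain_sphs Ox x0 y0).
  rewrite !mulf_eq0 !negb_or -andbA => /and3P[_ p0 T0].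
  rewrite /radial /spray_P /spray_Q -/(sphs x y).
  move: p0 T0 u0 r0.
  move: (ds (ds phi) _ _) (ds (dr phi) _ _) (ds phi _ _) (dr phi _ _) (phi _ _).
  move=> pss prs ps pr p p0 T0 u0 r0.
  by field; rewrite T0 u0 r0 p0.
have gu := fundamental_tensor_unit Ox y0.
have Gi : G 0 i = enorm y * radial (spray_P phi) x y * y 0 i
    + enorm y ^+ 2 * radial (spray_Q phi) x y * x 0 i by rewrite !mxE.
rewrite -Gi /spray.
under eq_bigr do rewrite key -gform_mx.
have -> : G 0 i = (invmx (fundamental_tensor F x y) *m
    (fundamental_tensor F x y *m G^T)) i 0 by rewrite mulKmx// [RHS]mxE.
rewrite [RHS]mxE mulr_sumr; apply: eq_bigr => l _.
rewrite mulrCA mulKf ?pnatr_eq0//; congr (_ * _).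
by rewrite -mulmxA -rowE [LHS]mxE.
Qed.

End Spray.

(** * The Riemann curvature *)

Section CurvatureEquations.
Context (R : realType).
Variables (P Q : R -> R -> R).

(** [curvA], [curvP] and [curvQ] are the left-hand sides A, E and C of the three equations, in this
    order. *)
Definition curvA (r s : R) : R :=
  2 * Q r s - s / r * dr P r s - ds P r s
  + 2 * (r ^+ 2 - s ^+ 2) * ds P r s * Q r s + P r s ^+ 2 + 2 * s * P r s * Q r s.

Definition curvP (r s : R) : R :=
  1 / (2 * r) * dr P r s - s / (2 * r) * ds (dr P) r s
  - 1 / 2 * ds (ds P) r s + P r s * Q r s - s * ds P r s * Q r s
  + (r ^+ 2 - s ^+ 2) * ds (ds P) r s * Q r s.

Definition curvQ (r s : R) : R :=
  2 / r * dr Q r s - ds (ds Q) r s - s / r * ds (dr Q) r s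
  + 2 * (r ^+ 2 - s ^+ 2) * Q r s * ds (ds Q) r s
  + 4 * Q r s ^+ 2 - (r ^+ 2 - s ^+ 2) * ds Q r s ^+ 2
  - 2 * s * Q r s * ds Q r s.

(** The coefficient B of - y_i h_j in the curvature, in the form in which the direct computation
    yields it. *)
Definition curvB (r s : R) : R :=
  2 / r * dr P r s - s / r * ds (dr P) r s - ds (ds P) r s - ds Q r s
  + 2 * Q r s * (P r s + (r ^+ 2 - s ^+ 2) * ds (ds P) r s - s * ds P r s)
  - P r s * ds P r s - ds Q r s * (s * P r s + (r ^+ 2 - s ^+ 2) * ds P r s).

(** The relation B = 3 E - A_s / 2, through which the second equation enters. Differentiating P_r in
    s gives P_rs in the order used by the equations, so no exchange of partial derivatives
    occurs. *)
Lemma is_derive_curvA (W : set (R * R)) r s : open W -> smooth2 W P -> smooth2 W Q ->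
  W (r, s) -> r != 0 ->
  is_derive s 1 (curvA r) (2 * (3 * curvP r s - curvB r s)).
Proof.
move=> oW CP CQ Wrs r0; rewrite /curvA /curvP /curvB.
have DP := is_derive_ds oW CP Wrs.
have DQ := is_derive_ds oW CQ Wrs.
have DPs := is_derive_ds oW (smooth2_ds CP) Wrs.
have DPr := is_derive_ds oW (smooth2_dr CP) Wrs.
have Dt := is_derive_id s (1 : R).
set ri := r^-1.
notypeclasses refine (is_derive_eq _ _).
  repeat derive_step ltac:(first [exact DP | exact DQ | exact DPs | exact DPr | exact Dt
    | notypeclasses refine (is_derive_pcst (r ^+ 2) _ _)]).
cbv beta; rewrite /ri.
generalize (ds (ds P) r s) (ds (dr P) r s) (dr P r s) (ds P r s) (ds Q r s) (P r s) (Q r s).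
by move=> *; field.
Qed.

End CurvatureEquations.

(** * Closed form of the Riemann curvature *)

Section Riemann.
Context (R : realType) (n : nat).
Variables (Omega : set 'rV[R]_n) (W : set (R * R)) (P Q : R -> R -> R)
  (F : 'rV[R]_n -> 'rV[R]_n -> R).
Hypotheses (oO : open Omega) (oW : open W) (OW : rs_domain Omega `<=` W)
  (CP : smooth2 W P) (CQ : smooth2 W Q)
  (FE : forall x y i, Omega x -> x != 0 -> y != 0 -> spray F i x y =
     enorm y * radial P x y * y 0 i + enorm y ^+ 2 * radial Q x y * x 0 i).

Section At.
Variables (x : 'rV[R]_n).
Hypotheses (Ox : Omega x) (x0 : x != 0).

Lemma dx_spray i k y : y != 0 -> dx k (spray F i) x y =
  (enorm y * radial (dr P) x y * (x 0 k / enorm x) + radial (ds P) x y * y 0 k) * y 0 i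
  + (enorm y ^+ 2 * radial (dr Q) x y * (x 0 k / enorm x)
     + enorm y * radial (ds Q) x y * y 0 k) * x 0 i
  + enorm y ^+ 2 * radial Q x y * (i == k)%:R.
Proof.
move=> y0; have u0 : enorm y != 0 by rewrite gt_eqF// enorm_gt0.
have r0 : enorm x != 0 by rewrite gt_eqF// enorm_gt0.
apply: (dxE oO Ox x0 (fun z Oz z0 => FE i Oz z0 y0)).
notypeclasses refine (is_derive_eq _ _).
  repeat derive_step ltac:(first [notypeclasses refine (is_derive_coordE x _ _)
   | notypeclasses refine (is_derive_radial_x oW OW Ox x0 y0 _ CP)
   | notypeclasses refine (is_derive_radial_x oW OW Ox x0 y0 _ CQ)]).
by cbv beta; generalize_radial; field; rewrite u0 r0.
Qed.

Lemma dy_spray i k y : y != 0 -> dy k (spray F i) x y =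
  (radial P x y * y 0 k / enorm y
     + radial (ds P) x y * (x 0 k - sphs x y * y 0 k / enorm y)) * y 0 i
  + enorm y * radial P x y * (i == k)%:R
  + (2 * radial Q x y * y 0 k
     + radial (ds Q) x y * (enorm y * x 0 k - sphs x y * y 0 k)) * x 0 i.
Proof.
move=> y0; have u0 : enorm y != 0 by rewrite gt_eqF// enorm_gt0.
apply: (dyE y0 (fun z z0 => FE i Ox x0 z0)).
notypeclasses refine (is_derive_eq _ _).
  repeat derive_step ltac:(first [notypeclasses refine (is_derive_coordE y _ _)
   | notypeclasses refine (is_derive_enorm_coord y0 _)
   | notypeclasses refine (is_derive_radial_y oW OW Ox x0 y0 _ CP)
   | notypeclasses refine (is_derive_radial_y oW OW Ox x0 y0 _ CQ)]).
by cbv beta; generalize_radial; field; rewrite u0.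
Qed.

(** Grouped by x_k, y_k and the two deltas, ready for [sum_contractionC]; c is the derivative of s
    with respect to y_j. The same holds for [dydy_spray]. *)
Lemma dydx_spray i j k y : y != 0 ->
  let c := x 0 j / enorm y - sphs x y * y 0 j / enorm y ^+ 2 in
  dy j (dx k (spray F i)) x y =
  ((y 0 j * radial (dr P) x y / enorm y + enorm y * radial (ds (dr P)) x y * c) * y 0 i
     + enorm y * radial (dr P) x y * (i == j)%:R
     + (2 * y 0 j * radial (dr Q) x y + enorm y ^+ 2 * radial (ds (dr Q)) x y * c) * x 0 i)
   / enorm x * x 0 k
  + (radial (ds (ds P)) x y * c * y 0 i + radial (ds P) x y * (i == j)%:R
     + (y 0 j / enorm y * radial (ds Q) x y + enorm y * radial (ds (ds Q)) x y * c) * x 0 i)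
   * y 0 k
  + (2 * y 0 j * radial Q x y + enorm y ^+ 2 * radial (ds Q) x y * c) * (i == k)%:R
  + (radial (ds P) x y * y 0 i + enorm y * radial (ds Q) x y * x 0 i) * (k == j)%:R.
Proof.
move=> y0; have u0 : enorm y != 0 by rewrite gt_eqF// enorm_gt0.
have r0 : enorm x != 0 by rewrite gt_eqF// enorm_gt0.
apply: (dyE y0 (fun z z0 => dx_spray i k z0)); set a := x 0 k / enorm x.
notypeclasses refine (is_derive_eq _ _).
  repeat derive_step ltac:(first [notypeclasses refine (is_derive_coordE y _ _)
   | notypeclasses refine (is_derive_enorm_coord y0 _)
   | notypeclasses refine (is_derive_radial_y oW OW Ox x0 y0 _ CQ)
   | notypeclasses refine (is_derive_radial_y oW OW Ox x0 y0 _ (smooth2_dr CP))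
   | notypeclasses refine (is_derive_radial_y oW OW Ox x0 y0 _ (smooth2_dr CQ))
   | notypeclasses refine (is_derive_radial_y oW OW Ox x0 y0 _ (smooth2_ds CP))
   | notypeclasses refine (is_derive_radial_y oW OW Ox x0 y0 _ (smooth2_ds CQ))]).
by rewrite /a; cbv beta; generalize_radial; field; rewrite u0 r0.
Qed.

Lemma dydy_spray i j k y : y != 0 ->
  let c := x 0 j / enorm y - sphs x y * y 0 j / enorm y ^+ 2 in
  dy j (dy k (spray F i)) x y =
  (radial (ds (ds P)) x y * c * y 0 i + radial (ds P) x y * (i == j)%:R
    + (enorm y * radial (ds (ds Q)) x y * c + radial (ds Q) x y * y 0 j / enorm y) * x 0 i)
   * x 0 k
  + ((sphs x y * radial (ds P) x y * y 0 j / enorm y ^+ 3 - radial P x y * y 0 j / enorm y ^+ 3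
      - sphs x y * radial (ds (ds P)) x y * c / enorm y) * y 0 i
     + (radial P x y - sphs x y * radial (ds P) x y) / enorm y * (i == j)%:R
     + (radial (ds Q) x y - sphs x y * radial (ds (ds Q)) x y) * c * x 0 i) * y 0 k
  + (radial P x y * y 0 j / enorm y
     + radial (ds P) x y * (x 0 j - sphs x y * y 0 j / enorm y)) * (i == k)%:R
  + ((radial P x y - sphs x y * radial (ds P) x y) / enorm y * y 0 i
     + (2 * radial Q x y - sphs x y * radial (ds Q) x y) * x 0 i) * (k == j)%:R.
Proof.
move=> y0; have u0 : enorm y != 0 by rewrite gt_eqF// enorm_gt0.
apply: (dyE y0 (fun z z0 => dy_spray i k z0)).
notypeclasses refine (is_derive_eq _ _).
  repeat derive_step ltac:(first [exact u0 | notypeclasses refine (is_derive_coordE y _ _)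
   | notypeclasses refine (is_derive_enorm_coord y0 _)
   | notypeclasses refine (is_derive_sphs_y x y0 _)
   | notypeclasses refine (is_derive_radial_y oW OW Ox x0 y0 _ CP)
   | notypeclasses refine (is_derive_radial_y oW OW Ox x0 y0 _ CQ)
   | notypeclasses refine (is_derive_radial_y oW OW Ox x0 y0 _ (smooth2_ds CP))
   | notypeclasses refine (is_derive_radial_y oW OW Ox x0 y0 _ (smooth2_ds CQ))]).
by cbv beta; generalize_radial; field; rewrite u0.
Qed.

Lemma RiemannE i j y : y != 0 ->
  Riemann_curvature F i j x y =
  curvA P Q (enorm x) (sphs x y) * (enorm y ^+ 2 * (i == j)%:R - y 0 i * y 0 j)
  - (enorm y * curvQ Q (enorm x) (sphs x y) * x 0 i + curvB P Q (enorm x) (sphs x y) * y 0 i)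
    * (sphs x y * y 0 j - enorm y * x 0 j).
Proof.
move=> y0; have u0 : enorm y != 0 by rewrite gt_eqF// enorm_gt0.
have r0 : enorm x != 0 by rewrite gt_eqF// enorm_gt0.
(* The factors of the three sums are brought to the shape of [sum_contraction], with zero
   coefficients for absent terms. *)
have hy k : y 0 k = 0 * x 0 k + 1 * y 0 k + 0 * (k == j)%:R by ring.
have hG k : spray F k x y = enorm y ^+ 2 * radial Q x y * x 0 k
    + enorm y * radial P x y * y 0 k + 0 * (k == j)%:R.
  by rewrite FE//; generalize_radial; ring.
have hdG k : dy k (spray F i) x y =
    (radial (ds P) x y * y 0 i + enorm y * radial (ds Q) x y * x 0 i) * x 0 k
    + ((radial P x y - sphs x y * radial (ds P) x y) / enorm y * y 0 i
       + (2 * radial Q x y - sphs x y * radial (ds Q) x y) * x 0 i) * y 0 k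
    + enorm y * radial P x y * (i == k)%:R + 0 * (k == j)%:R.
  by rewrite dy_spray//; generalize_radial; field.
have hdGj k : dy j (spray F k) x y =
    (2 * radial Q x y * y 0 j
       + radial (ds Q) x y * (enorm y * x 0 j - sphs x y * y 0 j)) * x 0 k
    + (radial P x y * y 0 j / enorm y
       + radial (ds P) x y * (x 0 j - sphs x y * y 0 j / enorm y)) * y 0 k
    + enorm y * radial P x y * (k == j)%:R.
  by rewrite dy_spray//; generalize_radial; ring.
have E4 (a b c d a' b' c' d' : R) : a = a' -> b = b' -> c = c' -> d = d' ->
  2 * a - b + 2 * c - d = 2 * a' - b' + 2 * c' - d' by move=> -> -> -> ->.
apply: etrans (E4 _ _ _ _ _ _ _ _ (dx_spray i j y0)
  (sum_contractionC (fun k => dydx_spray i j k y0) hy)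
  (sum_contractionC (fun k => dydy_spray i j k y0) hG) (sum_contraction hdG hdGj)) _.
rewrite (dot_sphs x y0) -!sqr_enorm /curvA /curvQ /curvB /radial.
generalize (dr P (enorm x) (sphs x y)) (ds (dr P) (enorm x) (sphs x y))
  (ds (ds P) (enorm x) (sphs x y))
  (ds P (enorm x) (sphs x y)) (P (enorm x) (sphs x y)) (dr Q (enorm x) (sphs x y))
  (ds (dr Q) (enorm x) (sphs x y)) (ds (ds Q) (enorm x) (sphs x y))
  (ds Q (enorm x) (sphs x y)) (Q (enorm x) (sphs x y)).
move=> pr prs pss ps p qr qrs qss qs q.
(* The remaining identity holds for an arbitrary value in place of the Kronecker delta. *)
by move: (i == j)%:R => d; field; rewrite u0 r0.
Qed.

End At.
End Riemann.

(** * Smoothness on the slit tangent bundle *)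

Section SlitBundle.
Context (R : realType) (n : nat).
Variable (Omega : set 'rV[R]_n).
Hypothesis (oO : open Omega).
Implicit Types (f : 'rV[R]_n -> 'rV[R]_n -> R).

Definition slit : set ('rV[R]_n * 'rV[R]_n) := [set p | Omega p.1 /\ p.2 != 0].

Definition smoothTM f := smooth_on slit (fun p => f p.1 p.2).

Lemma open_slit : open slit.
Proof.
rewrite openE => p [Op p0]; apply: filterI.
  exact: (cvg_fst (open_nbhs_nbhs (conj oO Op))).
exact: (cvg_snd (near_neq0 p0)).
Qed.
Let oS := open_slit.

Lemma smoothTM_dx k f : smoothTM f -> smoothTM (dx k f).
Proof.
move=> Cf; rewrite /smoothTM.
rewrite (_ : (fun p => _) = 'D_((delta_mx 0 k, 0) : 'rV[R]_n * 'rV[R]_n) (fun p => f p.1 p.2)).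
  exact: smooth_on_derive Cf.
apply/funext => -[x y]; rewrite /dx /derive; set g1 := (fun h => _); set g2 := (fun h => _).
suff -> : g1 = g2 by [].
by apply/funext => h; rewrite /g1 /g2 /= scaler0 add0r.
Qed.

Lemma smoothTM_dy k f : smoothTM f -> smoothTM (dy k f).
Proof.
move=> Cf; rewrite /smoothTM.
rewrite (_ : (fun p => _) = 'D_((0, delta_mx 0 k) : 'rV[R]_n * 'rV[R]_n) (fun p => f p.1 p.2)).
  exact: smooth_on_derive Cf.
apply/funext => -[x y]; rewrite /dy /derive; set g1 := (fun h => _); set g2 := (fun h => _).
suff -> : g1 = g2 by [].
by apply/funext => h; rewrite /g1 /g2 /= scaler0 add0r.
Qed.

Lemma smoothTM_coord i : smoothTM (fun _ y => y 0 i).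
Proof.
apply: smooth_on_linear.
  by move=> a x y; rewrite !mxE.
move=> p; apply: (@continuous_comp _ _ _ snd (fun z : 'rV[R]_n => z 0 i)).
  exact: cvg_snd.
exact: coord_continuous.
Qed.

Variable (F : 'rV[R]_n -> 'rV[R]_n -> R).
Hypotheses (CF : smoothTM F)
  (F_unit : forall x y, Omega x -> y != 0 -> fundamental_tensor F x y \in unitmx).

Lemma smoothTM_sqrF : smoothTM (sqrF F).
Proof. exact: smooth_onX. Qed.

Lemma smoothTM_fundamental_tensor i j :
  smoothTM (fun x y => fundamental_tensor F x y i j).
Proof.
rewrite /smoothTM; under [X in smooth_on _ X]eq_fun do rewrite mxE.
apply: smooth_onM => //; first exact: smooth_on_cst.
by apply: smoothTM_dy; apply: smoothTM_dy; exact: smoothTM_sqrF.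
Qed.

Lemma smoothTM_gform (v w : 'rV[R]_n -> 'rV[R]_n) :
  (forall i, smoothTM (fun _ y => v y 0 i)) ->
  (forall i, smoothTM (fun _ y => w y 0 i)) ->
  smoothTM (fun x y => gform F x y (v y) (w y)).
Proof.
move=> Cv Cw; apply: smooth_on_sum => // i; apply: smooth_on_sum => // j.
apply: smooth_onM => //; last exact: Cw.
by apply: smooth_onM => //; [exact: smoothTM_fundamental_tensor|exact: Cv].
Qed.

Lemma smoothTM_spray i : smoothTM (spray F i).
Proof.
apply: smooth_onM => //; first exact: smooth_on_cst.
apply: smooth_on_sum => // l; apply: smooth_onM => //.
  apply: smooth_on_invmx => //; first by move=> p [] /F_unit; exact.
  by move=> a b; exact: smoothTM_fundamental_tensor.
apply: smooth_onB => //; last by apply: smoothTM_dx; exact: smoothTM_sqrF.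
apply: smooth_on_sum => // k; apply: smooth_onM => //; last exact: smoothTM_coord.
by apply: smoothTM_dy; apply: smoothTM_dx; exact: smoothTM_sqrF.
Qed.

Lemma smoothTM_Riemann i j : smoothTM (Riemann_curvature F i j).
Proof.
have CG := smoothTM_spray.
apply: smooth_onB => //; [apply: smooth_onD => //; [apply: smooth_onB => //|]|].
- by apply: smooth_onM => //; [exact: smooth_on_cst|exact: smoothTM_dx].
- apply: smooth_on_sum => // k; apply: smooth_onM => //; first exact: smoothTM_coord.
  by apply: smoothTM_dy; exact: smoothTM_dx.
- apply: smooth_onM => //; first exact: smooth_on_cst.
  apply: smooth_on_sum => // k; apply: smooth_onM => //; first exact: CG.
  by apply: smoothTM_dy; exact: smoothTM_dy.
- by apply: smooth_on_sum => // k; apply: smooth_onM => //; exact: smoothTM_dy.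
Qed.

(** Formulas in r and s are available only for x nonzero. Along a line t v with v nonzero, f is
    derivable at t = 0, hence continuous there, and it vanishes for small nonzero t. *)
Lemma vanish_at_origin (hn : (0 < n)%N) f y : smoothTM f -> Omega 0 -> y != 0 ->
  (forall x, Omega x -> x != 0 -> f x y = 0) -> f 0 y = 0.
Proof.
move=> Cf O0 y0 f0.
pose v : 'rV[R]_n := const_mx 1.
have v0 : v != 0.
  apply/eqP => /rowP/(_ (Ordinal hn)); rewrite !mxE => /eqP; by rewrite oner_eq0.
have := @smooth_on_derivable _ _ _ _ ((v, 0) : 'rV[R]_n * 'rV[R]_n) (0, y) Cf (conj O0 y0).
move=> /derivable1P/derivable1_diffP/differentiable_continuous cf.
apply/eqP; apply: contraT => fn0.
have nf : \forall t \near (0 : R), f (t *: v) y != 0.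
  have /cvgr_neq0 := cf; rewrite /= !scale0r !add0r => /(_ fn0).
  by apply: filterS => t; rewrite scaler0 add0r addr0.
have nO : \forall t \near (0 : R), Omega (t *: v).
  have cv : {for (0 : R), continuous (fun t : R => t *: v)} by exact: scalel_continuous.
  apply: cv; apply: open_nbhs_nbhs; split => //; by rewrite scale0r.
have [t [[ft Ot] t0]] : exists t : R, (f (t *: v) y != 0 /\ Omega (t *: v)) /\ t != 0.
  apply: (@filter_ex _ (0 : R)^'); apply: filterI.
    by apply: nbhs_dnbhs; exact: filterI.
  exact: (@nbhs_dnbhs_neq R (0 : R)).
by move: ft; rewrite f0 ?eqxx// scaler_eq0 negb_or t0.
Qed.

End SlitBundle.

(** * Flags *)

Section Flags.
Context (R : realType) (n : nat).
Variable (F : 'rV[R]_n -> 'rV[R]_n -> R).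
Implicit Types (x y v w : 'rV[R]_n).

Definition flag_num x y w : R :=
  gform F x y (\row_i \sum_(k < n) Riemann_curvature F i k x y * w 0 k) w.

Definition flag_den x y w : R := F x y ^+ 2 * gform F x y w w - gform F x y y w ^+ 2.

Lemma flag_curvatureE x y w : flag_curvature F x y w = flag_num x y w / flag_den x y w.
Proof.
congr (_ / _); apply: eq_bigr => i _; apply: eq_bigr => j _.
by rewrite [(\row__ _) _ _]mxE mulr_sumr mulr_suml; apply: eq_bigr => k _; ring.
Qed.

Lemma gformDl x y v1 v2 w : gform F x y (v1 + v2) w = gform F x y v1 w + gform F x y v2 w.
Proof. by rewrite -!gform_mx !mulmxDl mxE. Qed.

Lemma gformZl x y a v w : gform F x y (a *: v) w = a * gform F x y v w.
Proof. by rewrite -!gform_mx -!scalemxAl mxE. Qed.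

Lemma gformDr x y v1 v2 w : gform F x y w (v1 + v2) = gform F x y w v1 + gform F x y w v2.
Proof. by rewrite -!gform_mx linearD mulmxDr mxE. Qed.

Lemma gformZr x y a v w : gform F x y w (a *: v) = a * gform F x y w v.
Proof. by rewrite -!gform_mx linearZ -!scalemxAr mxE. Qed.

Lemma gform0l x y w : gform F x y 0 w = 0.
Proof. by rewrite -(scale0r w) gformZl mul0r. Qed.

Lemma free_pairP y w : reflect (w != 0 /\ forall k, y != k *: w) (free [:: y; w]).
Proof.
rewrite free_cons span_seq1 seq1_free andbC; apply: (iffP andP) => -[w0 yw]; split => //.
  by move=> k; apply: contra yw => /eqP ->; apply/vlineP; exists k.
by apply/vlineP => -[k yk]; have := yw k; rewrite yk eqxx.
Qed.

(** The strict Cauchy-Schwarz inequality for g: z = g(y,y) w - g(y,w) y is nonzero, and g(z,z) is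
    g(y,y) times the denominator. Symmetry and g(y,y) = F^2 are premises because at x = 0 they are
    obtained by continuity. *)
Lemma flag_den_gt0 x y w :
  (forall v, v != 0 -> 0 < gform F x y v v) -> gform F x y w y = gform F x y y w ->
  gform F x y y y = F x y ^+ 2 -> free [:: y; w] -> 0 < flag_den x y w.
Proof.
move=> pd sym gyy /free_pairP[w0 yw].
have y0 : y != 0 by have := yw 0; rewrite scale0r.
have gy0 := pd _ y0; rewrite /flag_den -gyy.
pose z := gform F x y y y *: w + (- gform F x y y w) *: y.
have z0 : z != 0.
  apply/eqP => z0.
  have [b0|b0] := eqVneq (gform F x y y w) 0.
    by move/eqP: z0; rewrite /z b0 oppr0 scale0r addr0 scaler_eq0 (negbTE w0) gt_eqF.
  have := yw ((gform F x y y w)^-1 * gform F x y y y).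
  move: z0; rewrite /z scaleNr => /eqP; rewrite subr_eq0 => /eqP e.
  by rewrite -scalerA e scalerA mulVf// scale1r eqxx.
have := pd _ z0; rewrite /z gformDl !gformDr !gformZl !gformZr sym.
move: gy0; move: (gform F x y y y) (gform F x y y w) (gform F x y w w) => a b c a0.
have -> : a * (a * c) + a * (- b * b) + (- b * (a * b) + - b * (- b * a)) =
  a * (a * c - b ^+ 2) by ring.
by rewrite pmulr_rgt0.
Qed.

End Flags.

(** * The flag identity and its pointwise consequences *)

Section FlagIdentity.
Context (R : realType) (n : nat).
Variables (Omega : set 'rV[R]_n) (U : set (R * R)) (phi : R -> R -> R)
  (F : 'rV[R]_n -> 'rV[R]_n -> R).
Hypotheses (oO : open Omega) (oU : open U) (OW : rs_domain Omega `<=` regular_domain U phi)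
  (Cphi : smooth2 U phi)
  (FE : forall x y, Omega x -> y != 0 -> F x y = enorm y * radial phi x y)
  (F_pd : forall x y v, Omega x -> y != 0 -> v != 0 -> 0 < gform F x y v v).

Let OU : rs_domain Omega `<=` U. Proof. by move=> p /OW[]. Qed.

Let P := spray_P phi.
Let Q := spray_Q phi.
Let A := curvA P Q.
Let B := curvB P Q.
Let C := curvQ Q.

Variables (x y : 'rV[R]_n).
Hypotheses (Ox : Omega x) (x0 : x != 0) (y0 : y != 0).

(* A covector vanishing at y; it is zero exactly when x and y are parallel. *)
Definition hcov (w : 'rV[R]_n) : R := sphs x y * dot y w - enorm y * dot x w.

Lemma gform_y w : gform F x y y w =
  radial phi x y ^+ 2 * dot y w - radial phi x y * radial (ds phi) x y * hcov w.
Proof.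
have u0 : enorm y != 0 by rewrite gt_eqF// enorm_gt0.
rewrite (gformE oU OU Cphi FE Ox x0 _ _ y0) (dot_sphs x y0) -sqr_enorm /hcov.
by generalize_radial; field.
Qed.

Lemma gform_yy : gform F x y y y = F x y ^+ 2.
Proof.
rewrite gform_y /hcov (dot_sphs x y0) -sqr_enorm FE//.
by generalize_radial; ring.
Qed.

Lemma gformC v w : gform F x y v w = gform F x y w v.
Proof.
by rewrite !(gformE oU OU Cphi FE Ox x0 _ _ y0) (dotC v w); generalize_radial; ring.
Qed.

(** The curvature formula gives R w = A (u^2 w - <y,w> y) - h(w) (u C x + B y). Replacing one factor
    g(y,w) by phi^2 <y,w> - phi phi_s h(w) turns the denominator into phi^2 (u^2 g(w,w) - <y,w>
    g(y,w)) + phi phi_s h(w) g(y,w). *)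
Lemma flag_identity (K : R) w :
  flag_num F x y w - K * flag_den F x y w =
  (A (enorm x) (sphs x y) - K * radial phi x y ^+ 2)
    * (enorm y ^+ 2 * gform F x y w w - dot y w * gform F x y y w)
  - hcov w * gform F x y ((enorm y * C (enorm x) (sphs x y)) *: x
     + (B (enorm x) (sphs x y) + K * radial phi x y * radial (ds phi) x y) *: y) w.
Proof.
pose oW := open_regular_domain oU Cphi.
have CP := smooth_spray_P oU Cphi; have CQ := smooth_spray_Q oU Cphi.
have SE x1 y1 i (O1 : Omega x1) (x10 : x1 != 0) (y10 : y1 != 0) :=
  sprayE oO oU OW Cphi FE F_pd i O1 x10 y10.
have RE i j := RiemannE oO oW OW CP CQ SE Ox x0 i j y0.
have -> : flag_num F x y w = gform F x y ((A (enorm x) (sphs x y) * enorm y ^+ 2) *: w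
  + (- (A (enorm x) (sphs x y) * dot y w) - hcov w * B (enorm x) (sphs x y)) *: y
  + (- (hcov w * enorm y * C (enorm x) (sphs x y))) *: x) w.
  congr (gform F x y _ w); apply/rowP => i; rewrite !mxE.
  rewrite (eq_bigr (fun k => A (enorm x) (sphs x y) * enorm y ^+ 2 * ((i == k)%:R * w 0 k)
    + (- (A (enorm x) (sphs x y) * y 0 i)
       - (enorm y * C (enorm x) (sphs x y) * x 0 i + B (enorm x) (sphs x y) * y 0 i) * sphs x y)
       * (y 0 k * w 0 k)
    + (enorm y * C (enorm x) (sphs x y) * x 0 i + B (enorm x) (sphs x y) * y 0 i) * enorm y
       * (x 0 k * w 0 k))); last first.
    move=> k _; rewrite RE -/A -/B -/C.
    generalize (A (enorm x) (sphs x y)) (B (enorm x) (sphs x y)) (C (enorm x) (sphs x y)).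
    by move=> *; ring.
  rewrite !big_split/= -!mulr_sumr -!/(dot _ _).
  rewrite (bigD1 i)//= eqxx mul1r big1 ?addr0; last first.
    by move=> k ki; rewrite eq_sym (negbTE ki) mul0r.
  rewrite /hcov.
  generalize (A (enorm x) (sphs x y)) (B (enorm x) (sphs x y)) (C (enorm x) (sphs x y)).
  by move=> *; ring.
rewrite /flag_den FE// !gformDl !gformZl.
have := gform_y w.
generalize (A (enorm x) (sphs x y)) (B (enorm x) (sphs x y)) (C (enorm x) (sphs x y)).
move: (gform F x y y w) (gform F x y w w) (gform F x y x w) (hcov w) => gyw gww gxw h a b c.
by generalize_radial => ->; ring.
Qed.

Lemma hcov_y : hcov y = 0.
Proof. by rewrite /hcov (dot_sphs x y0) -sqr_enorm; ring. Qed.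

Lemma hcovD v w : hcov (v + w) = hcov v + hcov w.
Proof. by rewrite /hcov !dotDr; ring. Qed.

Lemma hcovZ a w : hcov (a *: w) = a * hcov w.
Proof. by rewrite /hcov !dotZr; ring. Qed.

Lemma hcov_x : hcov x = - (enorm y * (enorm x ^+ 2 - sphs x y ^+ 2)).
Proof. by rewrite /hcov (dotC y) (dot_sphs x y0) sqr_enorm; ring. Qed.

Lemma hcov_free w : hcov w != 0 -> free [:: y; w].
Proof.
move=> hw; apply/free_pairP; split.
  by apply: contraNneq hw => ->; rewrite -(scale0r 0) hcovZ mul0r.
move=> k; apply/eqP => yk; have := hcov_y; rewrite yk hcovZ => /eqP.
rewrite mulf_eq0 (negbTE hw) orbF => /eqP k0.
by move: y0; rewrite yk k0 scale0r eqxx.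
Qed.

Lemma constant_flag_necessary (hn : (2 < n)%N) (K : R) :
  `|sphs x y| < enorm x ->
  (forall w, free [:: y; w] -> flag_num F x y w = K * flag_den F x y w) ->
  [/\ A (enorm x) (sphs x y) = K * radial phi x y ^+ 2,
      B (enorm x) (sphs x y) + K * radial phi x y * radial (ds phi) x y = 0 &
      C (enorm x) (sphs x y) = 0].
Proof.
move=> sr cK; have u0 := enorm_gt0 y0.
have rs : 0 < enorm x ^+ 2 - sphs x y ^+ 2.
  rewrite subr_gt0 -(real_normK (num_real (sphs x y))).
  by rewrite ltr_sqr ?nnegrE// ltW// (le_lt_trans _ sr).
(* A vector w orthogonal to x and y has h(w) = 0, which isolates the A-term of the identity. *)
have AK : A (enorm x) (sphs x y) = K * radial phi x y ^+ 2.
  have [w [w0 xw yw]] := exists_orthogonal hn x y.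
  have fw : free [:: y; w].
    apply/free_pairP; split=> // k; apply/eqP => yk.
    by have := dot_gt0 y0; rewrite {2}yk dotZr yw mulr0 ltxx.
  have := flag_identity K w; rewrite cK// subrr /hcov xw yw !(mulr0, mul0r, subr0).
  move/esym/eqP; rewrite mulf_eq0 => /orP[|]; first by rewrite subr_eq0 => /eqP.
  by rewrite gt_eqF// mulr_gt0 ?exprn_gt0// F_pd.
set B' := B _ _ + _; set C' := C _ _ in AK *.
pose z := (enorm y * C') *: x + B' *: y.
have hL w : hcov w != 0 -> gform F x y z w = 0.
  move=> hw; have := flag_identity K w; rewrite cK ?hcov_free// subrr AK subrr mul0r sub0r.
  by move/esym/eqP; rewrite oppr_eq0 mulf_eq0 (negbTE hw) => /eqP.
have hx : hcov x != 0 by rewrite hcov_x oppr_eq0 mulf_neq0// gt_eqF.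
(* Now g(z, w) = 0 whenever h(w) is nonzero. If h(z) = 0, this applies to both x and x + z, so that
   g(z, z) = 0 by subtraction. *)
have z0 : z = 0.
  apply/eqP; apply: contraT => zn0; have := F_pd Ox y0 zn0.
  have [hz|hz] := eqVneq (hcov z) 0; last by rewrite hL// ltxx.
  have := hL (x + z); rewrite hcovD hz addr0 => /(_ hx).
  by rewrite gformDr hL// add0r => ->; rewrite ltxx.
(* Applying h to z = 0 removes the y-term, since h(y) = 0, while h(x) is nonzero. *)
have C0 : C' = 0.
  have := congr1 hcov z0; rewrite /z hcovD !hcovZ hcov_y mulr0 addr0.
  rewrite -(scale0r 0) hcovZ mul0r => /eqP; rewrite !mulf_eq0 (gt_eqF u0) (negbTE hx) orbF/=.
  by move/eqP.
split => //; move/eqP: z0; rewrite /z C0 mulr0 scale0r add0r scaler_eq0 (negbTE y0) orbF.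
by move/eqP.
Qed.

(** B and C enter the identity only multiplied by h(w), which is zero for every w when |s| = r; they
    are therefore constrained only for |s| < r. *)
Lemma constant_flag_sufficient (K : R) w :
  A (enorm x) (sphs x y) = K * radial phi x y ^+ 2 ->
  (`|sphs x y| < enorm x ->
    B (enorm x) (sphs x y) + K * radial phi x y * radial (ds phi) x y = 0 /\
    C (enorm x) (sphs x y) = 0) ->
  flag_num F x y w = K * flag_den F x y w.
Proof.
move=> AK BC; apply/eqP; rewrite -subr_eq0 flag_identity AK subrr mul0r sub0r oppr_eq0.
have [_ _ sr] := rs_domain_sphs Ox x0 y0; rewrite /= in sr.
have [/BC[-> ->]|rs] := ltP `|sphs x y| (enorm x).
  by rewrite mulr0 !scale0r addr0 gform0l mulr0.
have {sr rs}sr : sphs x y ^+ 2 = enorm x ^+ 2.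
  by rewrite -(real_normK (num_real (sphs x y))) (le_anti (introT andP (conj sr rs))).
have u0 : enorm y != 0 by rewrite gt_eqF// enorm_gt0.
(* |s| = r means that x and y are parallel *)
pose e := enorm y *: x + (- sphs x y) *: y.
have e0 : e = 0.
  apply/eqP; rewrite -dot_eq0 /e dotDl !dotDr !dotZl !dotZr (dotC y x) (dot_sphs x y0).
  rewrite -!sqr_enorm -sr; apply/eqP; ring.
have hw : hcov w = - dot e w by rewrite /e dotDl !dotZl /hcov; ring.
by rewrite hw e0 dot0l oppr0 mul0r.
Qed.

End FlagIdentity.

(** * The curvature equations *)

Section CurvatureEquationsRegularity.
Context (R : realType).

Section Smooth.
Variables (W : set (R * R)) (P Q : R -> R -> R).
Hypotheses (oW : open W) (W0 : forall p, W p -> p.1 != 0)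
  (CP : smooth2 W P) (CQ : smooth2 W Q).

Let Cinv (c : R) : c != 0 -> smooth2 W (fun r _ => (c * r)^-1).
Proof.
move=> c0; apply: smooth_onV => //; first by move=> p /W0 p0; rewrite mulf_neq0.
by apply: smooth_onM => //; [exact: smooth_on_cst|exact: smooth2_fst].
Qed.

Let Cinv1 : smooth2 W (fun r _ => r^-1).
Proof. by apply: smooth_onV => //; exact: smooth2_fst. Qed.

Local Ltac smooth := repeat first
  [ exact: smooth_on_cst | exact: smooth2_fst | exact: smooth2_snd
  | exact: Cinv1 | (apply: Cinv; rewrite pnatr_eq0)
  | exact: CP | exact: CQ | apply: smooth2_dr | apply: smooth2_ds | apply: smooth_onD => //
  | apply: smooth_onN => // | apply: smooth_onM => // | apply: smooth_onX => //].

Lemma smooth_curvA : smooth2 W (curvA P Q).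
Proof. by rewrite /smooth2 /curvA; smooth. Qed.

Lemma smooth_curvP : smooth2 W (curvP P Q).
Proof. by rewrite /smooth2 /curvP; smooth. Qed.

Lemma smooth_curvQ : smooth2 W (curvQ Q).
Proof. by rewrite /smooth2 /curvQ; smooth. Qed.

End Smooth.

Lemma zero_up_to_boundary (f : R -> R) (r s : R) : 0 < r -> `|s| <= r ->
  {for s, continuous f} -> (forall t, `|t| < r -> f t = 0) -> f s = 0.
Proof.
move=> r0; rewrite le_eqVlt => /orP[/eqP sr|sr] cf f0; last exact: f0.
apply/eqP; apply: contraT => fs.
have /nbhs_ballP[d /= d0 fd] : \forall t \near s, f t != 0 by exact: cvgr_neq0 cf fs.
(* The point s (1 - t) is interior because 0 < t <= 1/2, and its distance r t to s is at most d /
   2. *)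
pose t := Num.min (2^-1) (d / (2 * r)).
have t0 : 0 < t by rewrite lt_min invr_gt0 ltr0n/= divr_gt0// mulr_gt0.
have t1 : t <= 2^-1 by rewrite ge_min lexx.
have td : t <= d / (2 * r) by rewrite ge_min lexx orbT.
have := fd (s * (1 - t)); rewrite f0 ?eqxx; last first.
  rewrite normrM sr gtr_pMr// ger0_norm; last by lra.
  by lra.
apply; rewrite -ball_normE /ball_/= mulrBr mulr1 opprB addrC subrK.
rewrite normrM sr (gtr0_norm t0) (le_lt_trans (ler_wpM2l (ltW r0) td))//.
rewrite (_ : r * _ = d / 2); last by field; rewrite gt_eqF.
by lra.
Qed.

(** With r fixed, the equation A = K phi^2 holds for all t near s, so it can be differentiated: 2 (3
    E - B) = 2 K phi phi_s. *)
Lemma curvA_derivative (W W' : set (R * R)) (P Q phi : R -> R -> R) (K r s : R) :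
  open W -> open W' -> smooth2 W P -> smooth2 W Q -> smooth2 W' phi ->
  W (r, s) -> W' (r, s) -> r != 0 -> `|s| < r ->
  (forall t, `|t| < r -> curvA P Q r t = K * phi r t ^+ 2) ->
  3 * curvP P Q r s - curvB P Q r s = K * phi r s * ds phi r s.
Proof.
move=> oW oW' CP CQ Cphi Wrs W'rs r0 sr AK.
have [_ DA] := is_derive_curvA oW CP CQ Wrs r0.
have [_ Dphi] := is_derive_pmul (is_derive_pcst K s 1)
  (is_derive_psqr (is_derive_ds oW' Cphi W'rs)).
have E : \near s, curvA P Q r s = K * phi r s ^+ 2.
  have : \forall t \near s, `|t| < r.
    have cn : {for s, continuous (fun t : R => `|t|)} by exact: norm_continuous.
    exact: (@cvgr_lt R R (nbhs s) _ (fun t : R => `|t|) `|s| cn r sr).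
  by apply: filterS => t /AK.
move: Dphi; rewrite -(near_eq_derive _ E) DA mulr0 addr0 => D.
apply: (@mulfI _ 2); first by rewrite pnatr_eq0.
by rewrite D; ring.
Qed.

End CurvatureEquationsRegularity.

(** * Equivalence of constant flag curvature and the equations *)

Section Main.
Context (R : realType) (n : nat) (hn : (2 < n)%N).
Variables (Omega : set 'rV[R]_n) (U : set (R * R)) (phi : R -> R -> R)
  (F : 'rV[R]_n -> 'rV[R]_n -> R).
Hypotheses (oO : open Omega) (oU : open U) (OU : rs_domain Omega `<=` U)
  (Cphi : smooth2 U phi) (CF : smoothTM Omega F)
  (phi_gt0 : forall r s, rs_domain Omega (r, s) -> 0 < phi r s)
  (FE : forall x y, Omega x -> y != 0 -> F x y = enorm y * radial phi x y)
  (F_pd : forall x y v, Omega x -> y != 0 -> v != 0 -> 0 < gform F x y v v).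

Let OW : rs_domain Omega `<=` regular_domain U phi.
Proof. exact: rs_domain_regular OU Cphi FE phi_gt0 F_pd hn. Qed.

Let n0 : (0 < n)%N. Proof. by case: (n) hn. Qed.

Let F_unit x y := fundamental_tensor_unit F_pd (x := x) (y := y).

Let oS := open_slit oO.

Let smooth_const (w : 'rV[R]_n) i : smoothTM Omega (fun _ _ => w 0 i).
Proof. exact: smooth_on_cst. Qed.

Let smooth_id i : smoothTM Omega (fun _ y : 'rV[R]_n => y 0 i).
Proof. exact: smoothTM_coord. Qed.

Let smooth_ww w := smoothTM_gform oO CF (smooth_const w) (smooth_const w).
Let smooth_wy w := smoothTM_gform oO CF (smooth_const w) smooth_id.
Let smooth_yw w := smoothTM_gform oO CF smooth_id (smooth_const w).
Let smooth_yy := smoothTM_gform oO CF smooth_id smooth_id.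

(** Symmetry of g and g(y,y) = F^2 are read off from the closed forms for x nonzero, and extended to
    x = 0 by [vanish_at_origin]. *)
Lemma flag_den_neq0 x y w : Omega x -> free [:: y; w] -> flag_den F x y w != 0.
Proof.
move=> Ox yw.
have y0 : y != 0 by have /free_pairP[_ /(_ 0)] := yw; rewrite scale0r.
rewrite gt_eqF//; apply: flag_den_gt0 => //; first by move=> v; exact: F_pd.
  have [x0|x0] := eqVneq x 0; last exact: (gformC oU OW Cphi FE Ox x0 y0).
  apply/eqP; rewrite x0 -subr_eq0; rewrite x0 in Ox.
  apply/eqP; apply: (vanish_at_origin oO n0 (f := fun x y => gform F x y w y - gform F x y y w))
    => // [|z Oz z0].
    by apply: smooth_onB => //; [exact: smooth_wy|exact: smooth_yw].
  by rewrite (gformC oU OW Cphi FE Oz z0 y0 w) subrr.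
have [x0|x0] := eqVneq x 0; last exact: (gform_yy oU OW Cphi FE Ox x0 y0).
apply/eqP; rewrite x0 -subr_eq0; rewrite x0 in Ox.
apply/eqP; apply: (vanish_at_origin oO n0 (f := fun x y => gform F x y y y - F x y ^+ 2))
  => // [|z Oz z0].
  by apply: smooth_onB => //; exact: smooth_onX.
by rewrite (gform_yy oU OW Cphi FE Oz z0 y0) subrr.
Qed.

Lemma flag_constant_origin (K : R) y w : Omega 0 -> y != 0 ->
  (forall x, Omega x -> x != 0 -> flag_num F x y w = K * flag_den F x y w) ->
  flag_num F 0 y w = K * flag_den F 0 y w.
Proof.
move=> O0 y0 num; apply/eqP; rewrite -subr_eq0; apply/eqP.
apply: (vanish_at_origin oO n0 (f := fun x y => flag_num F x y w - K * flag_den F x y w))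
  => // [|z Oz z0]; last by rewrite num// subrr.
apply: smooth_onB => //.
  apply: smooth_on_sum => // i; apply: smooth_on_sum => // j.
  apply: smooth_onM => //; last exact: smooth_on_cst.
  apply: smooth_onM => //; first exact: smoothTM_fundamental_tensor.
  under [X in smooth_on _ X]eq_fun do rewrite mxE.
  apply: smooth_on_sum => // k; apply: smooth_onM => //; last exact: smooth_on_cst.
  exact: smoothTM_Riemann.
apply: smooth_onM => //; first exact: smooth_on_cst.
apply: smooth_onB => //; last by apply: smooth_onX => //; exact: smooth_yw.
by apply: smooth_onM => //; [exact: smooth_onX|exact: smooth_ww].
Qed.

Let P := spray_P phi.
Let Q := spray_Q phi.
Let W := regular_domain U phi.

Lemma constant_flag_curvatureP (K : R) :
  constant_flag_curvature Omega F K <->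
  (forall r s, rs_domain Omega (r, s) ->
    [/\ curvA P Q r s = K * phi r s ^+ 2, curvP P Q r s = 0 & curvQ Q r s = 0]).
Proof.
have oW : open W := open_regular_domain oU Cphi.
have CP : smooth2 W P := smooth_spray_P oU Cphi.
have CQ : smooth2 W Q := smooth_spray_Q oU Cphi.
have W0 p : W p -> p.1 != 0.
  by move=> [_]/=; rewrite !mulf_eq0 !negb_or => /andP[/andP[]].
have W1 : W `<=` U by move=> p [].
have Cphi' : smooth2 W phi := smooth_on_sub W1 Cphi.
split=> [cK r s rsD|eqs x y w Ox yw]; last first.
  have y0 : y != 0 by have /free_pairP[_ /(_ 0)] := yw; rewrite scale0r.
  rewrite flag_curvatureE; apply: (canLR (mulfK (flag_den_neq0 Ox yw))).
  have num z : Omega z -> z != 0 -> flag_num F z y w = K * flag_den F z y w.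
    move=> Oz z0; have rsD := rs_domain_sphs Oz z0 y0.
    have [AK cP cQ] := eqs _ _ rsD.
    apply: (constant_flag_sufficient oO oU OW Cphi FE F_pd Oz z0 y0) => // sr.
    split => //; have r0 := enorm_gt0 z0.
    (* With E = 0 the differentiated first equation reads - B = K phi phi_s, the required condition
       on B. *)
    have := curvA_derivative (K := K) oW oU CP CQ Cphi (OW rsD) (OU rsD) (lt0r_neq0 r0) sr.
    rewrite cP mulr0 sub0r => D; rewrite /radial -D ?subrr// => t tr.
    by have [] := eqs (enorm z) t; first by split => //=; [exists z|exact: ltW].
  have [x0|x0] := eqVneq x 0; last exact: num.
  by rewrite x0 in Ox *; exact: flag_constant_origin.
(* For the converse, interior pairs are realized by vectors x and y, where the pointwise necessary
   conditions apply. *)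
have int t : `|t| < r -> [/\ curvA P Q r t = K * phi r t ^+ 2,
    curvB P Q r t + K * phi r t * ds phi r t = 0 & curvQ Q r t = 0].
  case: rsD => -[z Oz /= zr] r0 _ tr.
  have rtD : rs_domain Omega (r, t) by split => //=; [exists z|exact: ltW].
  have [x [y [Ox x0 y0 xr ys]]] := rs_domain_realized hn rtD.
  have := constant_flag_necessary oO oU OW Cphi FE F_pd Ox x0 y0 hn (K := K).
  rewrite /radial xr ys; apply => // w yw.
  have := cK x y w Ox yw; rewrite flag_curvatureE => <-.
  by rewrite divfK// flag_den_neq0.
(* The differentiated first equation gives 3 E = B + K phi phi_s, and the right-hand side is already
   known to vanish. *)
have intP t : `|t| < r -> curvP P Q r t = 0.
  move=> tr; have [AK BK _] := int t tr.
  case: rsD => -[z Oz /= zr] r0 _.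
  have rtD : rs_domain Omega (r, t) by split => //=; [exists z|exact: ltW].
  have AK' t' : `|t'| < r -> curvA P Q r t' = K * phi r t' ^+ 2 by move=> /int[].
  have := curvA_derivative oW oU CP CQ Cphi (OW rtD) (OU rtD) (lt0r_neq0 r0) tr AK'.
  move/eqP; rewrite subr_eq => /eqP e3.
  apply: (@mulfI _ 3); first by rewrite pnatr_eq0.
  by rewrite e3 addrC BK mulr0.
have [_ /= r0 sr] := rsD.
have cont f : smooth2 W f -> {for s, continuous (f r)}.
  by move=> Cf; exact: smooth2_continuous oW Cf (OW rsD).
(* All three equations hold for |t| < r and extend to |s| = r by continuity in s. *)
split.
- apply/eqP; rewrite -subr_eq0; apply/eqP.
  apply: (zero_up_to_boundary (f := fun t => curvA P Q r t - K * phi r t ^+ 2) r0 sr).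
    apply: (cont (fun r t => curvA P Q r t - K * phi r t ^+ 2)).
    apply: smooth_onB => //; first exact: smooth_curvA.
    by apply: smooth_onM => //; [exact: smooth_on_cst|exact: smooth_onX].
  by move=> t /int[-> _ _]; rewrite subrr.
- apply: (zero_up_to_boundary r0 sr _ intP).
  by apply: cont; exact: smooth_curvP.
- apply: (zero_up_to_boundary (f := curvQ Q r) r0 sr); last by move=> t /int[].
  by apply: cont; exact: smooth_curvQ.
Qed.

End Main.

Theorem proposition5p1 (R : realType) (n : nat) (hn : (2 < n)%N)
  (Omega : set 'rV[R]_n) (hOmega : domain Omega)
  (F : 'rV[R]_n -> 'rV[R]_n -> R) (hF : Finsler_metric Omega F)
  (hsym : spherically_symmetric Omega F)
  (phi : R -> R -> R) (hphi : spherical_profile Omega F phi) (K : R) :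
  let Q := spray_Q phi in
  let P := spray_P phi in
  constant_flag_curvature Omega F K <->
  (forall r s : R, rs_domain Omega (r, s) ->
    [/\ 2 * Q r s - s / r * dr P r s - ds P r s
          + 2 * (r ^+ 2 - s ^+ 2) * ds P r s * Q r s
          + P r s ^+ 2 + 2 * s * P r s * Q r s
        = K * phi r s ^+ 2,
        1 / (2 * r) * dr P r s - s / (2 * r) * ds (dr P) r s
          - 1 / 2 * ds (ds P) r s + P r s * Q r s - s * ds P r s * Q r s
          + (r ^+ 2 - s ^+ 2) * ds (ds P) r s * Q r s
        = 0 &
        2 / r * dr Q r s - ds (ds Q) r s - s / r * ds (dr Q) r s
          + 2 * (r ^+ 2 - s ^+ 2) * Q r s * ds (ds Q) r s
          + 4 * Q r s ^+ 2 - (r ^+ 2 - s ^+ 2) * ds Q r s ^+ 2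
          - 2 * s * Q r s * ds Q r s
        = 0]).
Proof.
move=> Q P.
have [_ oO _] := hOmega; have [CF _ _ pd] := hF; have [FE phi_gt0 [U [oU OU Cphi]]] := hphi.
apply: (constant_flag_curvatureP hn oO oU OU Cphi CF phi_gt0 FE).
by move=> x y v Ox y0 v0; rewrite -gform_mx; exact: pd.
Qed.
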